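(* Let $f_{r+1},\dots,f_n\in R[x_1,\dots,x_n]$ with $0\le r\le n-1$, let $A=R[\mathbf{x}]/(f_{r+1},\dots,f_n)$ and $\overline{A}=A\otimes_Rk$, and suppose the ideal of $\overline{A}$ generated by the determinants of the $(n-r)\times(n-r)$ minors of $\mathrm{Jac}_{\overline{f}}$ is $\overline{A}$. Fix matrices $P$ (of size $n\times(n-r)$) and $\Delta_{r+1},\dots,\Delta_n$ (of size $(n-r)\times(n-r)$) over $R[\mathbf{x}]$ with $\mathrm{Jac}_f\cdot P\equiv\mathrm{Id}_{n-r}+\sum_{j=r+1}^nf_j\Delta_j$ modulo $\pi$, and let $$G(\mathbf{S})=f^\sigma(\psi(\mathbf{x})+\psi(P)\mathbf{S})-f^{p'}-\sum_{j=r+1}^nf_j^{p'}\psi(\Delta_j)\mathbf{S}.$$ Let $\mathbf{s}$ be the unique solution of $G(\mathbf{S})=0$ in $(\pi R\langle\mathbf{x}\rangle)^{n-r}$, let $\widehat\phi$ be the $\sigma$-semilinear endomorphism of $R\langle\mathbf{x}\rangle$ given by $\widehat\phi(\mathbf{x})=\psi(\mathbf{x})+\psi(P)\mathbf{s}$, and let $\widehat\phi_A$ be the $\sigma$-semilinear endomorphism of $R\langle\mathbf{x}\rangle/(f_{r+1},\dots,f_n)$ induced by $\widehat\phi$. Then $\widehat\phi_A$ gives a $\sigma$-semilinear endomorphism of $A^\dagger=R\langle\mathbf{x}\rangle^\dagger/(f_{r+1},\dots,f_n)$ that reduces to the $p'$-th power map on $\overline{A}$. The rate of convergence of the underlying endomorphism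 $\widehat\phi$ of $R\langle\mathbf{x}\rangle^\dagger$ can be explicitly estimated from the system $G(\mathbf{S})=0$ using the Newton iteration estimates (E1) and (E2) stated in the context.
   Context: $K$ is a finite extension of $\mathbb{Q}_p$ with valuation ring $R$, uniformiser $\pi$, residue field $k$, and valuation $v$ with $v(p)=1$. $\sigma$ is an automorphism of $K$ inducing $x\mapsto x^{p'}$ on $k$, with $p'$ a power of $p$. Bars denote reduction modulo $\pi$. $\mathbf{x}=(x_1,\dots,x_n)$, $\mathbf{S}=(S_{r+1},\dots,S_n)$. $R\langle\mathbf{x}\rangle$ is the ring of power series over $R$ with coefficients tending to $0$; $R\langle\mathbf{x}\rangle^\dagger$ is its subring of overconvergent series ($\sum a_I\mathbf{x}^I$ for which there are $\gamma>0$ and $\delta$ with $v(a_I)\ge\gamma|I|+\delta$ for all $I$). $\mathrm{Jac}_f$ is the Jacobian matrix of $f=(f_{r+1},\dots,f_n)$ with respect to $\mathbf{x}$; $\mathrm{Jac}_G$ is that of $G$ with respect to $\mathbf{S}$. $g^\sigma$ means $\sigma$ applied to the coefficients; $\psi$ is the $\sigma$-semilinear ring endomorphism of $R\langle\mathbf{x}\rangle$ with $\psi(x_i)=x_i^{p'}$, applied entrywise to matrices; $f^\sigma=(f_j^\sigma)_j$ and $f^{p'}=(f_j^{p'})_j$ as column vectors. For $\alpha\in(\mathbb{R}_{>0})^n$ and $\beta\in\mathbb{R}^n$, $\alpha^{-1}$ is the entrywise inverse, the dot is the inner product, $W(\alpha,\beta)=\{\sum a_D\mathbf{x}^D\in R\langle\mathbf{x}\rangle:v(a_D)\ge\alpha^{-1}\cdot(D-\beta)\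 \forall D\}$, and for $c\ge0$, $V(c)=\{\sum a_D\mathbf{x}^D\in R\langle\mathbf{x}\rangle:v(a_D)\ge c\ \forall D\}$. $\max^+$ denotes the maximum of $0$ and the listed values. (E1) Let $G=(G_{r+1},\dots,G_n)$ have entries in $R[\mathbf{x}][\mathbf{S}]$, and suppose $\alpha\in(\mathbb{R}_{>0})^n$, $b,c>0$, $\beta,\gamma\in\mathbb{R}^n$ and $z\in R\langle\mathbf{x}\rangle^{n-r}$ satisfy: (1) $z$ has entries in $W(\alpha,\beta)\cap V(b)$; (2) each $G_j(z)\in W(\alpha,\gamma)\cap V(c)$; (3) $\mathrm{Jac}_G(z)$ has entries in $W(\alpha,0)$ and determinant in $W(\alpha,0)^*$; (4) $\alpha^{-1}\cdot\gamma\le\alpha^{-1}\cdot\beta$. Write $G_j=\sum_{l=0}^N\sum_{|J|=l}G_{j,J}(\mathbf{x})\mathbf{S}^J$ for some $N\ge2$, with $G_{r+i,J}\in W(\alpha,\delta_{r+i,J})$ for $|J|\ge2$, and let $J^{(j)}$ be $J$ with $1$ subtracted in its $j$-th position. Let $z'=z-\mathrm{Jac}_G(z)^{-1}G(z)$. Then (1)–(4) hold for $z'$ with $b,c,\alpha,\beta,\gamma$ replaced by $b'=\min\{b,c\}$, $c'=2c$, $\alpha'=\alpha+\lambda\alpha$, $\beta'$, $\gamma'$, where $$\lambda=\max_{1\le i,j\le n-r}\ {\max}^+_{2\le|J|\le N,\ 0<L\le J^{(j)}}\left\{\alpha^{-1}\cdot\frac{\delta_{r+i,J}+(|J|-|L|-1)\beta+|L|\gamma}{(|J|-|L|-1)b+|L|c}\right\},$$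 $\beta'$ is chosen with $\alpha^{-1}\cdot\beta'=\alpha^{-1}\cdot\beta-\lambda b'$, and $\gamma'$ is chosen such that $\alpha^{-1}\cdot\gamma'$ is the maximum, over $1\le i\le n-r$, $2\le|J|\le N$, $0\le L\le J$ with $|L|\ge2$, of $\alpha^{-1}\cdot(\delta_{r+i,J}+(|J|-|L|)\beta+|L|\gamma)-\lambda((|J|-|L|)b+|L|c)$. If $b'=b$, further Newton iteration does not change $\alpha',\beta',b'$. (E2) If a $z$ as in (E1) exists, then $G(\mathbf{S})=0$ has a unique solution $\mathbf{s}$ with entries in $\pi R\langle\mathbf{x}\rangle^\dagger$, computable by Newton iteration $z_0=z$, $z_{m+1}=z_m-\mathrm{Jac}_G(z_m)^{-1}G(z_m)$. The iterate $z_2$ comes with $\alpha'',\beta'',b''$ (obtained by applying (E1) twice) that no longer change under further iteration, and all $z_m$ with $m\ge2$, as well as $\mathbf{s}$, have entries in $W(\alpha'',\beta'')$. As a simple estimate, all $z_m$ and $\mathbf{s}$ have entries in $W((1+\mu)\alpha,\beta)$ for $\mu=3c^{-1}M/2$, where $M=\max^+_{1\le i\le n-r,\ 2\le|J|\le N}\{\alpha^{-1}\cdot(\delta_{r+i,J}+(|J|-1)\beta)\}$. *)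

(* Defs.v *)
From HB Require Import structures.
From mathcomp Require Import all_boot all_order all_algebra.
From mathcomp Require Import generic_quotient ring_quotient fieldext mpoly.
From mathcomp Require Import boolp reals constructive_ereal.

Set Implicit Arguments.
Unset Strict Implicit.
Unset Printing Implicit Defensive.

Import Order.TTheory GRing.Theory Num.Theory.
Local Open Scope ring_scope.

Record valuation (RR : realType) (F : fieldType) := Valuation {
  vfun :> F -> \bar RR;
  val_neqNy : forall x, vfun x != -oo%E;
  val_eqy : forall x, (vfun x == +oo%E) = (x == 0);
  valM : forall x y, vfun (x * y)%R = (vfun x + vfun y)%E;
  valD : forall x y, (Order.min (vfun x) (vfun y) <= vfun (x + y)%R)%E }.

(** [F] with valuation [w] is the completion of the rationals for the p-adic
    valuation; this determines [(F, w)] up to unique isomorphism. *)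
Record is_padic_field (RR : realType) (p : nat) (F : fieldType)
    (w : valuation RR F) : Prop := {
  padic_nat : forall m : nat, (0 < m)%N -> w m%:R = (logn p m)%:R%:E;
  padic_dense : forall (a : F) (c : RR),
    exists q : rat, (c%:E <= w (a - ratr q)%R)%E;
  padic_complete : forall u : nat -> F,
    (forall c : RR, exists N, forall i j, (N <= i)%N -> (N <= j)%N ->
       (c%:E <= w (u i - u j)%R)%E) ->
    exists l : F, forall c : RR, exists N, forall i, (N <= i)%N ->
       (c%:E <= w (u i - l)%R)%E }.

Section ValuationRing.
Variables (RR : realType) (F : fieldType) (v : valuation RR F).

Definition vint : {pred F} := [pred x | (0 <= v x)%E].

Lemma val1 : v 1 = 0%E.
Proof.
have := valM v 1 1; rewrite mulr1.
have := val_neqNy v 1; have := val_eqy v 1; rewrite oner_eq0.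
case: (v 1) => [r| |] //= _ _ [] /eqP; rewrite -subr_eq0.
by rewrite opprD addNKr oppr_eq0 => /eqP ->.
Qed.

Lemma valN x : v (- x) = v x.
Proof.
suff vN1 : v (-1) = 0%E by rewrite -mulN1r valM vN1 add0e.
have := valM v (-1) (-1); rewrite mulrNN mulr1 val1.
have := val_neqNy v (-1); case: (v (-1)) => [r| |] //= _ [] /esym/eqP.
by rewrite -mulr2n mulrn_eq0 /= => /eqP ->.
Qed.

Lemma val0 : v 0 = +oo%E.
Proof. by apply/eqP; rewrite val_eqy. Qed.

Lemma valD_ge c x y : (c <= v x)%E -> (c <= v y)%E -> (c <= v (x + y)%R)%E.
Proof.
by move=> cx cy; apply: le_trans (valD v x y); rewrite le_min cx.
Qed.

Lemma val_sum_ge c (I : Type) (s : seq I) (P : pred I) (E : I -> F) :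
  (forall i, P i -> (c <= v (E i))%E) -> (c <= v (\sum_(i <- s | P i) E i)%R)%E.
Proof.
move=> cE; elim/big_ind: _ => //; first by rewrite val0 leey.
by move=> x y; apply: valD_ge.
Qed.

Fact vint_subring : subring_closed vint.
Proof.
split=> [|x y|x y]; rewrite !inE; first by rewrite val1.
  by move=> x0 y0; apply: valD_ge; rewrite ?valN.
by move=> x0 y0; rewrite valM adde_ge0.
Qed.
HB.instance Definition _ := GRing.isSubringClosed.Build F vint vint_subring.

Definition vring := {x : F | x \in vint}.
HB.instance Definition _ := SubChoice.on vring.
HB.instance Definition _ := [SubChoice_isSubComNzRing of vring by <:].

Definition vval (a : vring) : \bar RR := v (val a).

Definition uniformizer (pi : vring) : Prop :=
  pi != 0 /\ forall a : vring, (0 < vval a)%E <-> exists b, a = pi * b.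

Definition residue_field (k : fieldType) (red : {rmorphism vring -> k}) : Prop :=
  (forall y, exists a, red a = y) /\ (forall a, red a = 0 <-> (0 < vval a)%E).

End ValuationRing.

Section Ideal.
Variables (S : comPzRingType) (I : finType) (g : I -> S).

Definition gen_ideal : {pred S} :=
  fun a => `[< exists c : I -> S, a = \sum_i c i * g i >].

Lemma gen_idealP a :
  reflect (exists c : I -> S, a = \sum_i c i * g i) (a \in gen_ideal).
Proof. exact: asboolP. Qed.

Fact gen_ideal_zmod : zmod_closed gen_ideal.
Proof.
split; first by apply/gen_idealP; exists (fun=> 0); rewrite big1 // => i _; rewrite mul0r.
move=> a b /gen_idealP[c ->] /gen_idealP[d ->]; apply/gen_idealP.
exists (fun i => c i - d i); rewrite -sumrB.
by apply: eq_bigr => i _; rewrite mulrBl.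
Qed.
HB.instance Definition _ := GRing.isZmodClosed.Build S gen_ideal gen_ideal_zmod.

Lemma gen_idealMl x a : a \in gen_ideal -> x * a \in gen_ideal.
Proof.
move=> /gen_idealP[c ->]; apply/gen_idealP; exists (fun i => x * c i).
by rewrite mulr_sumr; apply: eq_bigr => i _; rewrite mulrA.
Qed.

(** The library only makes the quotient by a proper ideal into a ring; here the
    ideal may be the unit ideal, so the quotient may be the zero ring. *)
Definition quo := Quotient.quot gen_ideal.
HB.instance Definition _ := GRing.Zmodule.on quo.
HB.instance Definition _ := EqQuotient.on quo.

Definition cls (a : S) : quo := (\pi a)%qT.

Lemma clsP a b : cls a = cls b <-> a - b \in gen_ideal.
Proof.
rewrite /cls; split; first by move/eqP; rewrite piE Quotient.equivE.
by move=> ab; apply/eqP; rewrite piE Quotient.equivE.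
Qed.

Lemma cls_repr (x : quo) : cls (repr x) = x.
Proof. by rewrite /cls reprK. Qed.

Fact cls_zmod : zmod_morphism cls.
Proof. by move=> a b; rewrite /cls [LHS]raddfB. Qed.

Definition quo_mul (x y : quo) : quo := cls (repr x * repr y).

Lemma cls_mul a b : quo_mul (cls a) (cls b) = cls (a * b).
Proof.
apply/clsP; set a' := repr _; set b' := repr _.
have ia : a' - a \in gen_ideal by apply/clsP; rewrite cls_repr.
have ib : b' - b \in gen_ideal by apply/clsP; rewrite cls_repr.
have -> : a' * b' - a * b = b' * (a' - a) + a * (b' - b).
  by rewrite !mulrBr [b' * a']mulrC [b' * a]mulrC addrA subrK.
by rewrite rpredD ?gen_idealMl.
Qed.

Fact quo_mulA : associative quo_mul.
Proof.
move=> x y z; rewrite -(cls_repr x) -(cls_repr y) -(cls_repr z).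
by rewrite !cls_mul mulrA.
Qed.
Fact quo_mulC : commutative quo_mul.
Proof.
by move=> x y; rewrite -(cls_repr x) -(cls_repr y) !cls_mul mulrC.
Qed.
Fact quo_mul1 : left_id (cls 1) quo_mul.
Proof. by move=> x; rewrite -(cls_repr x) cls_mul mul1r. Qed.
Fact quo_mulDl : left_distributive quo_mul +%R.
Proof.
have clsD a b : cls a + cls b = cls (a + b).
  by rewrite -{1}[a](addrK b) [cls (_ - _)]cls_zmod subrK.
move=> x y z; rewrite -(cls_repr x) -(cls_repr y) -(cls_repr z).
by rewrite clsD !cls_mul clsD mulrDl.
Qed.
HB.instance Definition _ := GRing.Zmodule_isComPzRing.Build quo
  quo_mulA quo_mulC quo_mul1 quo_mulDl.

HB.instance Definition _ := GRing.isZmodMorphism.Build S quo cls cls_zmod.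
Fact cls_monoid : monoid_morphism cls.
Proof. by split=> // a b; rewrite -cls_mul. Qed.
HB.instance Definition _ := GRing.isMonoidMorphism.Build S quo cls cls_monoid.

End Ideal.

Record pseries (n : nat) (T : Type) := PSeries { scoef : 'X_{1..n} -> T }.

HB.instance Definition _ (n : nat) (T : Type) := gen_eqMixin (pseries n T).
HB.instance Definition _ (n : nat) (T : Type) := gen_choiceMixin (pseries n T).

Section PSeries.
Variables (n : nat) (T : comNzRingType).
Local Notation ps := (pseries n T).
Implicit Types f g h : ps.

Lemma pseriesP f g : (forall D, scoef f D = scoef g D) -> f = g.
Proof. by case: f g => [f] [g] /= fg; congr PSeries; apply: funext. Qed.

Definition ps_add f g : ps := PSeries (fun D => scoef f D + scoef g D).
Definition ps_opp f : ps := PSeries (fun D => - scoef f D).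
Definition ps_mul f g : ps := PSeries (fun D =>
  \sum_(E : 'X_{1..n < (mdeg D).+1} | (E <= D)%MM) scoef f E * scoef g (D - E)%MM).
Definition ps_poly (p : {mpoly T[n]}) : ps := PSeries (fun D => p@_D).

Fact ps_addA : associative ps_add.
Proof. by move=> f g h; apply: pseriesP => D /=; rewrite addrA. Qed.
Fact ps_addC : commutative ps_add.
Proof. by move=> f g; apply: pseriesP => D /=; rewrite addrC. Qed.
Fact ps_add0 : left_id (ps_poly 0) ps_add.
Proof. by move=> f; apply: pseriesP => D /=; rewrite mcoeff0 add0r. Qed.
Fact ps_addN : left_inverse (ps_poly 0) ps_opp ps_add.
Proof. by move=> f; apply: pseriesP => D /=; rewrite mcoeff0 addNr. Qed.
HB.instance Definition _ := GRing.isZmodule.Build ps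
  ps_addA ps_addC ps_add0 ps_addN.

Definition ps_trunc (d : nat) f : {mpoly T[n]} :=
  \sum_(E : 'X_{1..n < d}) scoef f E *: 'X_[E].

Lemma mcoeff_trunc d f D : (mdeg D < d)%N -> (ps_trunc d f)@_D = scoef f D.
Proof.
move=> Dd; rewrite /ps_trunc raddf_sum /= (bigD1 (BMultinom Dd)) //=.
rewrite mcoeffZ mcoeffX eqxx mulr1 big1 ?addr0 // => E nE.
rewrite mcoeffZ mcoeffX; case: eqP => [ED|]; last by rewrite mulr0.
by case/eqP: nE; apply: val_inj.
Qed.

Lemma eq_mcoeffM (p q p' q' : {mpoly T[n]}) D :
  (forall E, (mdeg E <= mdeg D)%N -> p@_E = p'@_E) ->
  (forall E, (mdeg E <= mdeg D)%N -> q@_E = q'@_E) ->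
  (p * q)@_D = (p' * q')@_D.
Proof.
move=> pp qq; rewrite !(mcoeff_poly_mul_lin _ _ (ltnSn (mdeg D))).
apply: eq_bigr => E ED; rewrite pp ?qq // -ltnS ?bmdeg //.
by rewrite ltnS mdegB.
Qed.

Lemma scoefM d f g D : (mdeg D < d)%N ->
  scoef (ps_mul f g) D = (ps_trunc d f * ps_trunc d g)@_D.
Proof.
move=> Dd; rewrite (mcoeff_poly_mul_lin _ _ (ltnSn (mdeg D))) /=.
apply: eq_bigr => E ED; rewrite !mcoeff_trunc //.
  by apply: leq_ltn_trans Dd; rewrite mdegB.
by apply: leq_trans Dd; apply: bmdeg.
Qed.

Lemma ps_trunc_mul d f g D : (mdeg D < d)%N ->
  (ps_trunc d (ps_mul f g))@_D = (ps_trunc d f * ps_trunc d g)@_D.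
Proof. by move=> Dd; rewrite mcoeff_trunc // (scoefM _ _ Dd). Qed.

Lemma ps_trunc_poly d p D : (mdeg D < d)%N -> (ps_trunc d (ps_poly p))@_D = p@_D.
Proof. by move=> Dd; rewrite mcoeff_trunc. Qed.

Fact ps_mulA : associative ps_mul.
Proof.
move=> f g h; apply: pseriesP => D; pose d := (mdeg D).+1.
rewrite !(scoefM (d := d)) //.
rewrite (@eq_mcoeffM _ _ (ps_trunc d f) (ps_trunc d g * ps_trunc d h)) //.
  by rewrite mulrA; apply: eq_mcoeffM => // E ED; rewrite ps_trunc_mul.
by move=> E ED; rewrite ps_trunc_mul.
Qed.
Fact ps_mulC : commutative ps_mul.
Proof.
move=> f g; apply: pseriesP => D.
by rewrite !(scoefM (d := (mdeg D).+1)) // mulrC.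
Qed.
Fact ps_mul1 : left_id (ps_poly 1) ps_mul.
Proof.
move=> f; apply: pseriesP => D; pose d := (mdeg D).+1.
rewrite (scoefM (d := d)) //.
rewrite (@eq_mcoeffM _ _ 1 (ps_trunc d f)) ?mul1r ?mcoeff_trunc //.
by move=> E ED; rewrite ps_trunc_poly.
Qed.
Fact ps_mulDl : left_distributive ps_mul +%R.
Proof.
move=> f g h; apply: pseriesP => D /=; rewrite -big_split /=.
by apply: eq_bigr => E _; rewrite mulrDl.
Qed.
Fact ps_1neq0 : ps_poly 1 != 0.
Proof.
apply/eqP => /(congr1 (fun f => scoef f 0%MM)) /=.
by rewrite mcoeff1 mcoeff0 eqxx => /eqP; rewrite oner_eq0.
Qed.
HB.instance Definition _ := GRing.Zmodule_isComNzRing.Build ps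
  ps_mulA ps_mulC ps_mul1 ps_mulDl ps_1neq0.

Fact ps_poly_zmod : zmod_morphism ps_poly.
Proof. by move=> p q; apply: pseriesP => D /=; rewrite mcoeffB. Qed.
HB.instance Definition _ :=
  GRing.isZmodMorphism.Build {mpoly T[n]} ps ps_poly ps_poly_zmod.
Fact ps_poly_monoid : monoid_morphism ps_poly.
Proof.
split=> // p q; apply: pseriesP => D.
rewrite [RHS](scoefM (d := (mdeg D).+1)) //=.
by apply: eq_mcoeffM => E ED; rewrite ps_trunc_poly.
Qed.
HB.instance Definition _ :=
  GRing.isMonoidMorphism.Build {mpoly T[n]} ps ps_poly ps_poly_monoid.

End PSeries.

Section Tate.
Variables (RR : realType) (F : fieldType) (v : valuation RR F) (n : nat).
Local Notation R := (vring v).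
Local Notation ps := (pseries n R).

Lemma vval_ge0 (a : R) : (0 <= vval a)%E.
Proof. exact: (valP a). Qed.
Lemma vval0 : vval (0 : R) = +oo%E. Proof. exact: val0. Qed.
Lemma vvalM (a b : R) : vval (a * b) = (vval a + vval b)%E.
Proof. exact: valM. Qed.
Lemma vvalB_ge c (a b : R) :
  (c <= vval a)%E -> (c <= vval b)%E -> (c <= vval (a - b)%R)%E.
Proof. by move=> ca cb; apply: valD_ge; rewrite ?valN. Qed.
Lemma vval_sum_ge c (I : Type) (s : seq I) (P : pred I) (E : I -> R) :
  (forall i, P i -> (c <= vval (E i))%E) ->
  (c <= vval (\sum_(i <- s | P i) E i)%R)%E.
Proof. by move=> cE; rewrite /vval raddf_sum; apply: val_sum_ge. Qed.

Definition null_coefs (g : ps) : Prop := forall c : RR,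
  exists N : nat, forall D, (N <= mdeg D)%N -> (c%:E <= vval (scoef g D))%E.

Definition overconvergent (g : ps) : Prop := exists c d : RR,
  0 < c /\ forall D, ((c * (mdeg D)%:R + d)%:E <= vval (scoef g D))%E.

Definition tate_pred : {pred ps} := fun g => `[< null_coefs g >].

Lemma null_poly (p : {mpoly R[n]}) : null_coefs (ps_poly p).
Proof.
move=> c; exists (msize p) => D pD /=.
by rewrite memN_msupp_eq0 ?vval0 ?leey //; apply: contraL pD => /msize_mdeg_lt; rewrite ltnNge.
Qed.

Fact tate_subring : subring_closed tate_pred.
Proof.
split=> [|f g|f g]; first by apply/asboolP; apply: null_poly.
  move=> /asboolP nf /asboolP ng; apply/asboolP => c.
  have [M fM] := nf c; have [N gN] := ng c; exists (M + N)%N => D MND /=.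
  apply: vvalB_ge; [apply: fM|apply: gN]; apply: leq_trans MND.
    exact: leq_addr.
  exact: leq_addl.
move=> /asboolP nf /asboolP ng; apply/asboolP => c.
have [M fM] := nf c; have [N gN] := ng c; exists (M + N)%N => D MND /=.
apply: vval_sum_ge => -[E /= _] ED; rewrite vvalM.
have [ME|EM] := leqP M (mdeg E).
  by rewrite -[c%:E]adde0 leeD ?fM ?vval_ge0.
rewrite -[c%:E]add0e leeD ?vval_ge0 // gN //.
have := mdegD E (D - E); rewrite addmC submK // => /esym DE.
by rewrite -(leq_add2l M) (leq_trans MND) // -DE leq_add2r ltnW.
Qed.
HB.instance Definition _ := GRing.isSubringClosed.Build ps tate_pred tate_subring.

Definition tate := {g : ps | g \in tate_pred}.
HB.instance Definition _ := SubChoice.on tate.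
HB.instance Definition _ := [SubChoice_isSubComNzRing of tate by <:].

Definition tcoef (g : tate) (D : 'X_{1..n}) : R := scoef (val g) D.

(** The unit structure is classical: it only serves to give a meaning to the
    inverse of a matrix over [tate]. *)
Definition tate_unit : {pred tate} := fun g => `[< exists h, h * g = 1 >].
Definition tate_inv (g : tate) : tate :=
  if pselect (exists h, h * g = 1) is left e then projT1 (cid e) else g.

Fact tate_mulVr : {in tate_unit, left_inverse 1 tate_inv *%R}.
Proof.
move=> g /asboolP ug; rewrite /tate_inv; case: pselect => // e.
by case: (cid e).
Qed.
Fact tate_unitP (g h : tate) : h * g = 1 -> g \in tate_unit.
Proof. by move=> hg; apply/asboolP; exists h. Qed.
Fact tate_inv_out : {in [predC tate_unit], tate_inv =1 id}.
Proof.
move=> g; rewrite inE /= /tate_inv; case: pselect => // e /negP[].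
exact/asboolP.
Qed.
HB.instance Definition _ := GRing.ComNzRing_hasMulInverse.Build tate
  tate_mulVr tate_unitP tate_inv_out.

Definition dagger_pred : {pred tate} := fun g => `[< overconvergent (val g) >].

Lemma overconvergent_poly (p : {mpoly R[n]}) : overconvergent (ps_poly p).
Proof.
exists 1, (- (msize p)%:R); split=> // D /=; rewrite mul1r.
have [pD|pD] := boolP (D \in msupp p); last first.
  by rewrite memN_msupp_eq0 // vval0 leey.
apply: le_trans (vval_ge0 _); rewrite lee_fin subr_le0 ler_nat ltnW //.
exact: msize_mdeg_lt.
Qed.

Fact dagger_subring : subring_closed dagger_pred.
Proof.
split=> [|f g|f g]; first by apply/asboolP; apply: overconvergent_poly.
  move=> /asboolP[c [d [c0 fcd]]] /asboolP[c' [d' [c'0 gcd]]].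
  apply/asboolP; exists (Num.min c c'), (Num.min d d').
  split=> [|D /=]; first by rewrite lt_min c0.
  by apply: vvalB_ge; [apply: le_trans (fcd D)|apply: le_trans (gcd D)];
    rewrite lee_fin lerD ?ler_wpM2r ?ge_min ?lexx ?orbT.
move=> /asboolP[c [d [c0 fcd]]] /asboolP[c' [d' [c'0 gcd]]].
apply/asboolP; exists (Num.min c c'), (d + d').
split=> [|D /=]; first by rewrite lt_min c0.
apply: vval_sum_ge => -[E /= _] ED; rewrite vvalM.
apply: le_trans (leeD (fcd E) (gcd (D - E)%MM)).
have := mdegD E (D - E); rewrite addmC submK // => ->.
rewrite -EFinD lee_fin natrD mulrDr addrACA.
by rewrite !lerD ?ler_wpM2r ?ge_min ?lexx ?orbT.
Qed.
HB.instance Definition _ :=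
  GRing.isSubringClosed.Build tate dagger_pred dagger_subring.

Definition dagger := {g : tate | g \in dagger_pred}.
HB.instance Definition _ := SubChoice.on dagger.
HB.instance Definition _ := [SubChoice_isSubComNzRing of dagger by <:].

Fact tpoly_key (p : {mpoly R[n]}) : ps_poly p \in tate_pred.
Proof. by apply/asboolP; apply: null_poly. Qed.
Definition tpoly (p : {mpoly R[n]}) : tate := exist _ (ps_poly p) (tpoly_key p).

Fact tpoly_zmod : zmod_morphism tpoly.
Proof. by move=> p q; apply: val_inj; rewrite /= [LHS]raddfB. Qed.
HB.instance Definition _ :=
  GRing.isZmodMorphism.Build {mpoly R[n]} tate tpoly tpoly_zmod.
Fact tpoly_monoid : monoid_morphism tpoly.
Proof.
split=> [|p q]; apply: val_inj; first by rewrite /= ?[LHS]rmorph1 ?rmorph1.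
by rewrite /= [LHS]rmorphM.
Qed.
HB.instance Definition _ :=
  GRing.isMonoidMorphism.Build {mpoly R[n]} tate tpoly tpoly_monoid.

Fact dpoly_key (p : {mpoly R[n]}) : tpoly p \in dagger_pred.
Proof. by apply/asboolP; apply: overconvergent_poly. Qed.
Definition dpoly (p : {mpoly R[n]}) : dagger := exist _ (tpoly p) (dpoly_key p).

Fact dpoly_zmod : zmod_morphism dpoly.
Proof. by move=> p q; apply: val_inj; rewrite /= [LHS]raddfB. Qed.
HB.instance Definition _ :=
  GRing.isZmodMorphism.Build {mpoly R[n]} dagger dpoly dpoly_zmod.
Fact dpoly_monoid : monoid_morphism dpoly.
Proof.
split=> [|p q]; apply: val_inj; first by rewrite /= ?[LHS]rmorph1 ?rmorph1.
by rewrite /= [LHS]rmorphM.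
Qed.
HB.instance Definition _ :=
  GRing.isMonoidMorphism.Build {mpoly R[n]} dagger dpoly dpoly_monoid.

Definition tconst (a : R) : tate := tpoly a%:MP.
Definition dconst (a : R) : dagger := dpoly a%:MP.

End Tate.

Section Weights.
Variables (RR : realType) (F : fieldType) (v : valuation RR F) (n : nat).
Local Notation R := (vring v).

Definition wt (alpha beta : 'rV[RR]_n) : RR :=
  \sum_i (alpha 0 i)^-1 * beta 0 i.

Definition mvec (D : 'X_{1..n}) : 'rV[RR]_n := \row_i (D i)%:R.

Definition inW (alpha beta : 'rV[RR]_n) (g : tate v n) : Prop :=
  forall D, ((wt alpha (mvec D - beta))%:E <= vval (tcoef g D))%E.

Definition inV (c : RR) (g : tate v n) : Prop :=
  forall D, (c%:E <= vval (tcoef g D))%E.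

Definition W0unit (alpha : 'rV[RR]_n) (g : tate v n) : Prop :=
  inW alpha 0 g /\ exists h, inW alpha 0 h /\ g * h = 1.

Definition is_max (E : RR -> Prop) (x : RR) : Prop :=
  E x /\ forall y, E y -> y <= x.

End Weights.

Section Newton.
Variables (RR : realType) (F : fieldType) (v : valuation RR F) (n m : nat).
Local Notation R := (vring v).
Local Notation Rx := {mpoly R[n]}.
Variable G : 'I_m -> {mpoly Rx[m]}.
Implicit Types z : 'cV[tate v n]_m.

Definition evalS z (p : {mpoly Rx[m]}) : tate v n :=
  mmap (@tpoly _ _ v n) (fun l => z l 0) p.

Definition Gval z : 'cV[tate v n]_m := \col_j evalS z (G j).

Definition JacG z : 'M[tate v n]_m := \matrix_(i, j) evalS z (mderiv j (G i)).

Definition newton z : 'cV[tate v n]_m := z - invmx (JacG z) *m Gval z.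

Record bounds := Bounds {
  b_alpha : 'rV[RR]_n; b_beta : 'rV[RR]_n; b_gamma : 'rV[RR]_n;
  b_b : RR; b_c : RR }.
Implicit Types P Q : bounds.

Definition newton_hyp P z : Prop :=
  [/\ [/\ forall i, 0 < b_alpha P 0 i, 0 < b_b P & 0 < b_c P],
      forall i, inW (b_alpha P) (b_beta P) (z i 0) /\ inV (b_b P) (z i 0),
      forall j, inW (b_alpha P) (b_gamma P) (Gval z j 0)
                /\ inV (b_c P) (Gval z j 0),
      (forall i j, inW (b_alpha P) 0 (JacG z i j))
        /\ W0unit (b_alpha P) (\det (JacG z)) &
      wt (b_alpha P) (b_gamma P) <= wt (b_alpha P) (b_beta P)].

(** [N] bounds the degree of [G] in [S]; [delta i J] is only relevant for
    [2 <= |J| <= N].  The same [delta] is used at all steps of the iteration: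
    the condition on it is preserved, since [alpha] can only increase. *)
Variables (N : nat) (delta : 'I_m -> 'X_{1..m} -> 'rV[RR]_n).

Definition coef_hyp (alpha : 'rV[RR]_n) : Prop :=
  [/\ (2 <= N)%N, forall i J, (N < mdeg J)%N -> (G i)@_J = 0 &
      forall i J, (2 <= mdeg J <= N)%N -> inW alpha (delta i J) (tpoly (G i)@_J)].

(** In the range [2 <= |J| <= N], [0 < L <= J^(j)], the multi-index [J^(j)]
    must be nonnegative, hence the condition [0 < J j]; then
    [|J| - |L| - 1] is a natural number. *)
Definition lambda P : RR :=
  \big[Num.max/0]_(i < m) \big[Num.max/0]_(j < m)
  \big[Num.max/0]_(J : 'X_{1..m < N.+1} | (2 <= mdeg J)%N && (0 < J j)%N)
  \big[Num.max/0]_(L : 'X_{1..m < N.+1} |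
                     (0 < mdeg L)%N && (L <= J - U_(j))%MM)
    (wt (b_alpha P) (delta i J + (mdeg J - mdeg L - 1)%:R *: b_beta P
                     + (mdeg L)%:R *: b_gamma P)
     / ((mdeg J - mdeg L - 1)%:R * b_b P + (mdeg L)%:R * b_c P)).

Definition gamma_value P (y : RR) : Prop :=
  exists (i : 'I_m) (J L : 'X_{1..m}),
    [/\ (2 <= mdeg J <= N)%N, (L <= J)%MM, (2 <= mdeg L)%N &
     y = wt (b_alpha P) (delta i J + (mdeg J - mdeg L)%:R *: b_beta P
                         + (mdeg L)%:R *: b_gamma P)
         - lambda P * ((mdeg J - mdeg L)%:R * b_b P + (mdeg L)%:R * b_c P)].

(** [beta'] and [gamma'] are only prescribed through their inner products with
    [alpha^-1], so this is a relation. *)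
Definition bounds_step P Q : Prop :=
  [/\ b_b Q = Num.min (b_b P) (b_c P), b_c Q = 2 * b_c P,
      b_alpha Q = b_alpha P + lambda P *: b_alpha P,
      wt (b_alpha P) (b_beta Q) = wt (b_alpha P) (b_beta P) - lambda P * b_b Q &
      is_max (gamma_value P) (wt (b_alpha P) (b_gamma Q))].

Definition bounds_chain P (Ps : nat -> bounds) : Prop :=
  Ps 0%N = P /\ forall t, bounds_step (Ps t) (Ps t.+1).

(** Since [beta] only matters through its inner product with [alpha^-1], "does
    not change" is expressed for that inner product. *)
Definition same_W P Q : Prop :=
  [/\ b_alpha Q = b_alpha P, b_b Q = b_b P &
      wt (b_alpha P) (b_beta Q) = wt (b_alpha P) (b_beta P)].

Definition newton_step_estimate P z : Prop :=
  [/\ exists Q, bounds_step P Q,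
      forall Q, bounds_step P Q -> newton_hyp Q (newton z) &
      forall Ps, bounds_chain P Ps -> b_b (Ps 1%N) = b_b P ->
        forall t, (1 <= t)%N -> same_W (Ps 1%N) (Ps t)].

Definition bigM P : RR :=
  \big[Num.max/0]_(i < m)
  \big[Num.max/0]_(J : 'X_{1..m < N.+1} | (2 <= mdeg J)%N)
    wt (b_alpha P) (delta i J + (mdeg J).-1%:R *: b_beta P).

Definition mu P : RR := 3 * (b_c P)^-1 * bigM P / 2.

Definition newton_limit_estimate P z (s : 'cV[tate v n]_m) : Prop :=
  let zs t := iter t newton z in
  [/\ forall c : RR, exists t0 : nat, forall t, (t0 <= t)%N ->
        forall i, inV c (zs t i 0 - s i 0),
      exists Ps, bounds_chain P Ps,
      forall Ps, bounds_chain P Ps ->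
        [/\ forall t, newton_hyp (Ps t) (zs t),
            forall t, (2 <= t)%N -> same_W (Ps 2%N) (Ps t),
            forall t, (2 <= t)%N ->
              forall i, inW (b_alpha (Ps 2%N)) (b_beta (Ps 2%N)) (zs t i 0) &
            forall i, inW (b_alpha (Ps 2%N)) (b_beta (Ps 2%N)) (s i 0)] &
      (forall t i, inW ((1 + mu P) *: b_alpha P) (b_beta P) (zs t i 0)) /\
      (forall i, inW ((1 + mu P) *: b_alpha P) (b_beta P) (s i 0))].

End Newton.

Section Frobenius.
Variables (RR : realType) (F : fieldType) (v : valuation RR F) (n m q : nat).
Local Notation R := (vring v).
Local Notation Rx := {mpoly R[n]}.
Variables (sigma : {rmorphism R -> R}).

(** The restriction to [R[x]] of the sigma-semilinear endomorphism of [R<x>]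
    that maps each variable to its [q]-th power. *)
Definition psi (p : Rx) : Rx := mmap (fun a => (sigma a)%:MP) (fun i => 'X_i ^+ q) p.

Definition Jac (T : comNzRingType) (f : 'I_m -> {mpoly T[n]}) : 'M[{mpoly T[n]}]_(m, n) :=
  \matrix_(j, i) mderiv i (f j).

Variables (f : 'I_m -> Rx) (P : 'M[Rx]_(n, m)) (Delta : 'I_m -> 'M[Rx]_m).

Definition Svec : 'cV[{mpoly Rx[m]}]_m := \col_l 'X_l.

(** [f^sigma(psi(x) + psi(P) S)]. *)
Definition fsigma_shift (j : 'I_m) : {mpoly Rx[m]} :=
  mmap (fun a => ((sigma a)%:MP)%:MP)
       (fun i => (psi 'X_i)%:MP
                 + (map_mx (fun p => (psi p)%:MP) P *m Svec) i 0)
       (f j).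

Definition frob_system (j : 'I_m) : {mpoly Rx[m]} :=
  fsigma_shift j - (f j ^+ q)%:MP
  - (\sum_l (f l ^+ q)%:MP *: (map_mx (fun p => (psi p)%:MP) (Delta l) *m Svec)) j 0.

Definition frob_image (s : 'cV[tate v n]_m) (i : 'I_n) : tate v n :=
  tpoly (psi 'X_i) + (map_mx (fun p => tpoly (psi p)) P *m s) i 0.

End Frobenius.

Definition pi_solution (RR : realType) (F : fieldType) (v : valuation RR F)
    (n m : nat) (pi : vring v) (G : 'I_m -> {mpoly {mpoly (vring v)[n]}[m]})
    (s : 'cV[tate v n]_m) : Prop :=
  (forall i, exists g : tate v n, s i 0 = tconst n pi * g) /\ Gval G s = 0.

(** The ideal of [T[x]/(f)] generated by the maximal minors of the Jacobian
    matrix of [f] is the unit ideal.  All choices [h] of columns are allowed: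
    repeated columns contribute 0, and reorderings only change the sign. *)
Definition jacobian_unit (n m : nat) (T : comNzRingType)
    (f : 'I_m -> {mpoly T[n]}) : Prop :=
  forall a : quo f,
    a \in gen_ideal (fun h : {ffun 'I_m -> 'I_n} => cls f (\det (colsub h (Jac f)))).

Definition sigma_semilinear (R : Type) (S : pzRingType) (iota : R -> S)
    (sigma : R -> R) (phi : S -> S) : Prop :=
  forall a x, phi (iota a * x) = iota (sigma a) * phi x.

Definition reduces_to (RR : realType) (F : fieldType) (v : valuation RR F)
    (n : nat) (k : fieldType) (red : {rmorphism vring v -> k})
    (g : tate v n) (p : {mpoly k[n]}) : Prop :=
  forall D, p@_D = red (tcoef g D).

(* Main.v *)
Require Import Defs.
From HB Require Import structures.
From mathcomp Require Import all_boot all_order all_algebra.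
From mathcomp Require Import generic_quotient ring_quotient fieldext mpoly.
From mathcomp Require Import boolp reals constructive_ereal.
From mathcomp Require Import ring lra zify.
Import Defs.

Set Implicit Arguments.
Unset Strict Implicit.
Unset Printing Implicit Defensive.

Import Order.TTheory GRing.Theory Num.Theory.
Local Open Scope ring_scope.

(** Set [h = z' - z] for one Newton step.  The Taylor expansion of [G] at [z]
    expresses [G(z')] and [Jac_G(z') - Jac_G(z)] through monomials
    [z^(J-L) h^L] with [|L| >= 2], resp. [|L| >= 1].  Each of them is bounded
    below both by an affine function of the exponent (from [W]) and by a constant
    (from [V]); a convex combination of the two bounds gives the slope
    [alpha' = (1 + lambda) alpha], and [lambda] is exactly what makes
    [Jac_G(z')] land in [W(alpha', 0)].

    Modulo [pi], and at any [z] divisible by [pi], the Frobenius in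
    characteristic [p] gives [G(z) = 0] and [Jac_G(z) = 1].  Hence [z = 0] starts
    the iteration (for [alpha] large), and the solution is unique because the
    difference of two solutions is divisible by ever higher powers of [pi].  The
    substitution [x |-> psi(x) + psi(P) s] extends by continuity to [R<x>], and
    [G(s) = 0] says that it maps [f_j] to [f_j^q + sum_l f_l^q (psi(Delta_l) s)_j],
    which is in the ideal [(f)]. *)

(** * Completeness of finite extensions *)

(** Each step multiplies [alpha] by [1 + lambda], so the limit is overconvergent only if the product
    of these factors stays bounded. It does, because [c] doubles while [b] becomes the minimum of
    [b] and [c]: from the first step on [b] is constant, and a step that leaves [b] unchanged makes
    every numerator of the next [lambda] nonpositive. At most two factors differ from 1, and the
    doubled [c] in the second one accounts for the 3/2 in [mu]. Limits occur for the iterates, for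
    the geometric series inverting a determinant, and for the extension of the substitution. They
    all rest on the completeness of [K], which has to be derived from that of the base field. The
    estimates concern an arbitrary admissible start and arbitrary choices of [beta'] and [gamma'].
    The limit reached is a root of positive valuation, hence divisible by [pi] because the valuation
    is discrete, and uniqueness identifies it with the [s] obtained from [z = 0]. *)

Section Valuation.
Variables (RR : realType) (F : fieldType) (v : valuation RR F).

Definition cauchy (u : nat -> F) := forall c : RR,
  exists N, forall i j, (N <= i)%N -> (N <= j)%N -> (c%:E <= v (u i - u j)%R)%E.

Definition converges (u : nat -> F) (l : F) := forall c : RR,
  exists N, forall i, (N <= i)%N -> (c%:E <= v (u i - l)%R)%E.

Lemma valB_ge c x y : (c <= v x)%E -> (c <= v y)%E -> (c <= v (x - y)%R)%E.
Proof. by move=> cx cy; apply: valD_ge; rewrite ?valN. Qed.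

Lemma valBC x y : v (x - y) = v (y - x).
Proof. by rewrite -valN opprB. Qed.

Lemma val_infty x : (forall c : RR, (c%:E <= v x)%E) -> x = 0.
Proof.
move=> cx; apply/eqP; rewrite -(val_eqy v).
have := cx (fine (v x) + 1); have := val_neqNy v x.
by case: (v x) => [r| |] //= _; rewrite lee_fin; lra.
Qed.

Lemma val_fin x : x != 0 -> exists r : RR, v x = r%:E.
Proof.
rewrite -(val_eqy v); have := val_neqNy v x.
by case: (v x) => [r| |] // _ _; exists r.
Qed.


Lemma lee_addfin (a b c : RR) (x y : \bar RR) :
  c <= a + b -> (a%:E <= x)%E -> (b%:E <= y)%E -> (c%:E <= x + y)%E.
Proof.
by move=> cab ax byy; apply: le_trans (leeD ax byy); rewrite -EFinD lee_fin.
Qed.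

Lemma val_close (c : RR) x y : (c%:E <= v y)%E -> (c%:E <= v (x - y)%R)%E ->
  (c%:E <= v x)%E.
Proof. by move=> cy cxy; rewrite -[x](subrK y); apply: valD_ge. Qed.

Lemma converges_cauchy u l : converges u l -> cauchy u.
Proof.
move=> ul c; have [N uN] := ul c; exists N => i j Ni Nj.
by rewrite -(subrKA l); apply: valD_ge; [exact: uN | rewrite valBC; exact: uN].
Qed.

End Valuation.

Section Complete.
Variables (RR : realType) (Qp : fieldType) (w : valuation RR Qp).
Variables (K : fieldExtType Qp) (v : valuation RR K).
Hypothesis w_complete : forall u, cauchy w u -> exists l, converges w u l.
Hypothesis v_ext : forall a : Qp, v (a%:A) = w a.

Let vscale a x : v (a *: x) = (w a + v x)%E.
Proof. by rewrite -mulr_algl valM v_ext. Qed.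

Definition complete_space (U : {vspace K}) := forall u : nat -> K,
  (forall i, u i \in U) -> cauchy v u -> exists2 l, l \in U & converges v u l.

(** If the valuations [v (e - x)] were unbounded, a sequence in [U] would converge to [e]; being
    Cauchy it has a limit in [U], and this limit must be [e]. *)
Lemma complete_space_dist (U : {vspace K}) e : complete_space U -> e \notin U ->
  exists C : RR, forall x, x \in U -> (v (e - x)%R <= C%:E)%E.
Proof.
move=> cU eU; apply: contrapT => noC.
have ex t : {x | x \in U & (t%:R%:E <= v (e - x)%R)%E}.
  apply: cid2; apply: contrapT => not; apply: noC; exists t%:R => x xU.
  by case: leP => // tx; case: not; exists x => //; apply: ltW.
pose u t := s2val (ex t).
have ux t : (t%:R%:E <= v (e - u t)%R)%E by rewrite /u; case: (ex t).
have uU t : u t \in U by rewrite /u; case: (ex t).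
have ue : converges v u e.
  move=> c; have [N cN] : exists N : nat, c <= N%:R.
    by exists (Num.truncn c).+1; apply: ltW; rewrite truncnS_gt.
  exists N => i Ni; rewrite valBC; apply: le_trans (ux i).
  by rewrite lee_fin (le_trans cN) // ler_nat.
have [l lU ul] := cU _ uU (converges_cauchy ue).
suff el : e = l by rewrite el lU in eU.
apply/eqP; rewrite -subr_eq0; apply/eqP; apply: (@val_infty _ _ v) => c.
have [N uN] := ue c; have [M uM] := ul c.
rewrite -(subrKA (u (M + N)%N)); apply: valD_ge.
  by rewrite valBC uN // leq_addl.
by rewrite uM // leq_addr.
Qed.

(** The bound [C] controls the coordinate along [e]: a vector whose coordinate [a] is nonzero has
    valuation at most [w a + C]. So the coordinates of a Cauchy sequence are Cauchy in the base
    field, and what remains is Cauchy in [U]. *)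
Lemma complete_space_add (U : {vspace K}) e : complete_space U ->
  complete_space (<[e]> + U)%VS.
Proof.
move=> cU; have [eU|eU] := boolP (e \in U).
  by rewrite (addv_idPr _) // -memvE.
have [C eC] := complete_space_dist cU eU; have e0 : e != 0.
  by apply: contraNneq eU => ->; rewrite mem0v.
have [ve vE] := val_fin v e0.
move=> u uU cu.
have dec i : {a : Qp | u i - a *: e \in U}.
  apply: cid; have /memv_addP[_ /vlineP[a ->] [y yU ->]] := uU i.
  by exists a; rewrite addrAC subrr add0r.
pose a i := projT1 (dec i); have aU i : u i - a i *: e \in U := projT2 (dec i).
have wa c i j : ((c + C)%:E <= v (u i - u j)%R -> c%:E <= w (a i - a j)%R)%E.
  move=> cij; have [->|aij] := eqVneq (a i - a j) 0; first by rewrite val0 leey.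
  have [r wr] := val_fin w aij; rewrite wr lee_fin.
  suff : (v (u i - u j)%R <= (r + C)%:E)%E by move/(le_trans cij); rewrite lee_fin lerD2r.
  (* Dividing by the coordinate turns the difference into a multiple of [e - y] with [y] in [U]. *)
  pose y := (a i - a j)^-1 *: ((u j - a j *: e) - (u i - a i *: e)).
  have yU : y \in U by rewrite memvZ // memvB.
  have -> : u i - u j = (a i - a j) *: (e - y).
    rewrite /y scalerBr scalerA divff // scale1r scalerBl.
    by rewrite !opprB !addrA; ring.
  by rewrite vscale wr EFinD leeD2lE // eC.
have ca : cauchy w a.
  move=> c; have [N uN] := cu (c + C); exists N => i j Ni Nj.
  by apply: wa; apply: uN.
have [l al] := w_complete ca.
have ale : converges v (fun i => a i *: e) (l *: e).
  move=> c; have [N aN] := al (c - ve); exists N => i Ni.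
  rewrite -scalerBl vscale vE.
  by apply: (@lee_addfin _ (c - ve) ve) (aN _ Ni) _; rewrite ?subrK.
have cy : cauchy v (fun i => u i - a i *: e).
  move=> c; have [N uN] := cu c; have [M aM] := converges_cauchy ale c.
  exists (N + M)%N => i j Ni Nj.
  have -> : u i - a i *: e - (u j - a j *: e) = (u i - u j) - (a i *: e - a j *: e) by ring.
  apply: valB_ge; [apply: uN|apply: aM]; lia.
have [y yU uy] := cU _ aU cy.
exists (l *: e + y); first by rewrite memv_add // memvZ // memv_line.
move=> c; have [N aN] := ale c; have [M yM] := uy c; exists (N + M)%N => i Ni.
have -> : u i - (l *: e + y) = (a i *: e - l *: e) + (u i - a i *: e - y) by ring.
by apply: valD_ge; [apply: aN|apply: yM]; lia.
Qed.

Lemma complete_span (X : seq K) : complete_space <<X>>%VS.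
Proof.
elim: X => [|e X IH]; last by rewrite span_cons; apply: complete_space_add.
move=> u uU _; exists 0; first exact: mem0v.
move=> c; exists 0%N => i _; have := uU i.
by rewrite span_nil memv0 => /eqP ->; rewrite subrr val0 leey.
Qed.

Lemma finite_ext_complete u : cauchy v u -> exists l, converges v u l.
Proof.
move=> cu; have uK i : u i \in <<vbasis {:K}>>%VS.
  by rewrite (span_basis (vbasisP _)) memvf.
by have [l _ ul] := complete_span uK cu; exists l.
Qed.

End Complete.

(** * Bounds on the coefficients in the Tate algebra *)

Section Uniformizer.
#[local] Arguments vval {RR F v} a%_R.
Variables (RR : realType) (F : fieldType) (v : valuation RR F).
Local Notation R := (vring v).

Lemma vval_ge_npos (c : RR) (a : R) : c <= 0 -> (c%:E <= vval a)%E.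
Proof. by move=> c0; apply: le_trans (vval_ge0 a); rewrite lee_fin. Qed.

Lemma vval_expr (e : RR) (a : R) k : vval a = e%:E -> vval (a ^+ k) = (k%:R * e)%:E.
Proof.
move=> va; elim: k => [|k IH]; first by rewrite expr0 mul0r /vval /= Defs.val1.
by rewrite exprS vvalM va IH -EFinD -natr1 mulrDl mul1r addrC.
Qed.

Lemma vval_expr_ge (e : RR) (a : R) k :
  (e%:E <= vval a)%E -> ((k%:R * e)%:E <= vval (a ^+ k))%E.
Proof.
move=> va; elim: k => [|k IH]; first by rewrite mul0r vval_ge0.
rewrite exprS vvalM; apply: lee_addfin va IH.
by rewrite -natr1 mulrDl mul1r addrC.
Qed.

Lemma vring_div (c : RR) (a b : R) :
  vval b = c%:E -> (c%:E <= vval a)%E -> exists d, a = b * d.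
Proof.
move=> vb va; have b0 : val b != 0 by rewrite -(val_eqy v) [v _]vb.
have dP : val a / val b \in vint v.
  rewrite inE; have [r vr] := val_fin v (invr_neq0 b0).
  have := Defs.valM v (val b) (val b)^-1; rewrite divff // Defs.val1 [v (val b)]vb vr.
  rewrite -EFinD => -[cr]; rewrite Defs.valM vr.
  by apply: (@lee_addfin _ c r) va _; rewrite ?cr.
exists (Sub (val a / val b) dP : R); apply: val_inj.
by rewrite rmorphM /= mulrC divfK.
Qed.

Variables (pi : R) (pi_unif : uniformizer pi).

Lemma uniformizer_val : exists2 e : RR, 0 < e & vval pi = e%:E.
Proof.
case: pi_unif => pi0 piP; have : (0 < vval pi)%E by apply/piP; exists 1; rewrite mulr1.
have [r vr] : exists r : RR, vval pi = r%:E.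
  by apply: val_fin; apply: contra pi0 => /eqP p0; apply/eqP/val_inj.
by rewrite vr lte_fin; exists r.
Qed.

Variables (e : RR) (e_gt0 : 0 < e) (pi_val : vval pi = e%:E).

Lemma vval_gt0_ge (a : R) : (0 < vval a)%E -> (e%:E <= vval a)%E.
Proof.
case: pi_unif => _ piP /piP[b ->]; rewrite vvalM pi_val.
by apply: (@lee_addfin _ e 0); rewrite ?addr0 ?vval_ge0.
Qed.

(** The valuation is discrete: with [k] the integer part of the quotient of the valuation of [a] by
    [e], the cofactor has valuation in [[0, e)], and a positive valuation is at least [e]. *)
Lemma uniformizer_decomp (a : R) : a != 0 ->
  exists k b, [/\ a = pi ^+ k * b, vval b = 0%E & vval a = (k%:R * e)%:E].
Proof.
move=> a0; have [r vr] : exists r : RR, vval a = r%:E.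
  by apply: val_fin; apply: contra a0 => /eqP p0; apply/eqP/val_inj.
have r0 : 0 <= r by rewrite -lee_fin -vr vval_ge0.
pose k := Num.truncn (r / e).
have /andP[kr rk] := truncn_itv (divr_ge0 r0 (ltW e_gt0)).
have {}kr : k%:R * e <= r by rewrite -ler_pdivlMr.
have {}rk : r < k.+1%:R * e by rewrite -ltr_pdivrMr.
have [] := @vring_div (k%:R * e) a (pi ^+ k); first exact: vval_expr.
  by rewrite vr lee_fin.
move=> b ab; exists k, b.
have va : vval a = ((k%:R * e)%:E + vval b)%E by rewrite ab vvalM (vval_expr k pi_val).
have vb : vval b = 0%E.
  apply/eqP; rewrite eq_le vval_ge0 andbT leNgt; apply/negP => /vval_gt0_ge eb.
  have : ((k.+1%:R * e)%:E <= vval a)%E.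
    by rewrite va; apply: (@lee_addfin _ (k%:R * e) e); rewrite // -natr1 mulrDl mul1r.
  by rewrite vr lee_fin leNgt rk.
by split=> //; rewrite va vb adde0.
Qed.

(** Only the power of [pi] in [a] matters, and a morphism preserving the maximal ideal sends
    [pi ^+ k] to valuation at least [k * e]. This is the continuity of sigma, without loss in the
    constant. *)
Lemma rmorph_contract (sigma : {rmorphism R -> R}) :
  (forall a, (0 < vval a)%E -> (0 < vval (sigma a))%E) ->
  forall (c : RR) a, (c%:E <= vval a)%E -> (c%:E <= vval (sigma a))%E.
Proof.
move=> sP c a; have [-> _|a0] := eqVneq a 0; first by rewrite rmorph0 vval0 leey.
have [k [b [-> vb ->]]] := uniformizer_decomp a0; rewrite lee_fin => ck.
rewrite rmorphM rmorphXn vvalM; apply: (@lee_addfin _ (k%:R * e) 0).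
- by rewrite addr0.
- by apply: vval_expr_ge; apply/vval_gt0_ge/sP; rewrite pi_val lte_fin.
- exact: vval_ge0.
Qed.

End Uniformizer.

Section TateBounds.
#[local] Arguments vval {RR F v} a%_R.
Variables (RR : realType) (F : fieldType) (v : valuation RR F) (n : nat).
Local Notation R := (vring v).
Local Notation tate := (tate v n).
Implicit Types (g h : tate) (om : 'X_{1..n} -> RR).

Lemma tateP g h : tcoef g =1 tcoef h -> g = h.
Proof. by move=> gh; apply/val_inj/pseriesP => D; apply: gh. Qed.

Lemma tcoefD g h D : tcoef (g + h) D = tcoef g D + tcoef h D. Proof. by []. Qed.
Lemma tcoefN g D : tcoef (- g) D = - tcoef g D. Proof. by []. Qed.
Lemma tcoef0 D : tcoef (0 : tate) D = 0.
Proof. by rewrite -(subrr (0 : tate)) tcoefD tcoefN subrr. Qed.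
Lemma tcoefB g h D : tcoef (g - h) D = tcoef g D - tcoef h D. Proof. by []. Qed.
Lemma tcoefM g h D : tcoef (g * h) D =
  \sum_(E : 'X_{1..n < (mdeg D).+1} | (E <= D)%MM) tcoef g E * tcoef h (D - E)%MM.
Proof. by []. Qed.
Lemma tcoef_poly (p : {mpoly R[n]}) D : tcoef (tpoly p) D = p@_D. Proof. by []. Qed.

Lemma tcoefCM a g D : tcoef (tconst n a * g) D = a * tcoef g D.
Proof.
have le0 : (0%MM <= D)%MM by apply/mnm_lepP => i; rewrite mnm0E.
rewrite tcoefM (bigD1 bm0) //= subm0 big1 ?addr0.
  by rewrite tcoef_poly mcoeffC eqxx mulr1.
move=> E /andP[_ E0]; rewrite tcoef_poly mcoeffC.
case: eqP => [E0'|]; last by rewrite mulr0 mul0r.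
by case/eqP: E0; apply: val_inj; rewrite /= -E0'.
Qed.

(** [inV c] and [inW alpha beta] are convertible to instances of this. *)
Definition coef_ge om g := forall D, ((om D)%:E <= vval (tcoef g D))%E.

Lemma coef_ge0 om : coef_ge om 0.
Proof. by move=> D; rewrite tcoef0 vval0 leey. Qed.

Lemma coef_geD om g h : coef_ge om g -> coef_ge om h -> coef_ge om (g + h).
Proof. by move=> og oh D; rewrite tcoefD; apply: Defs.valD_ge (og D) (oh D). Qed.

Lemma coef_geN om g : coef_ge om g -> coef_ge om (- g).
Proof. by move=> og D; rewrite tcoefN /vval raddfN valN; apply: og. Qed.

Lemma coef_geB om g h : coef_ge om g -> coef_ge om h -> coef_ge om (g - h).
Proof. by move=> og oh; apply/coef_geD/coef_geN. Qed.

Lemma coef_ge_sum om (I : Type) (s : seq I) (P : pred I) (E : I -> tate) :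
  (forall i, P i -> coef_ge om (E i)) -> coef_ge om (\sum_(i <- s | P i) E i).
Proof. by move=> oE; elim/big_ind: _ => //; [exact: coef_ge0|exact: coef_geD]. Qed.

Lemma coef_ge_le om om' g : (forall D, om' D <= om D) -> coef_ge om g -> coef_ge om' g.
Proof. by move=> oo og D; apply: le_trans (og D); rewrite lee_fin. Qed.

Lemma coef_geM om om1 om2 g h : (forall D E, om (D + E)%MM <= om1 D + om2 E) ->
  coef_ge om1 g -> coef_ge om2 h -> coef_ge om (g * h).
Proof.
move=> oo og oh D; rewrite tcoefM; apply: vval_sum_ge => -[E /= _] ED.
rewrite vvalM; apply: lee_addfin (og E) (oh _).
by rewrite -[X in om X](submK ED) addmC oo.
Qed.

Lemma inVM c c' g h : inV c g -> inV c' h -> inV (c + c') (g * h).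
Proof. exact: coef_geM. Qed.

Lemma inV_ge0 g : inV (0 : RR) g.
Proof. by move=> D; apply: vval_ge0. Qed.

Lemma inV_le c c' g : c' <= c -> inV c g -> inV c' g.
Proof. by move=> cc; apply: coef_ge_le. Qed.

Lemma inVMl c g h : inV c h -> inV c (g * h).
Proof. by move=> ch; rewrite -[c]add0r; apply: inVM => //; apply: inV_ge0. Qed.

Lemma inVX c g k : inV c g -> inV (k%:R * c) (g ^+ k).
Proof.
move=> cg; elim: k => [|k IH]; first by rewrite mul0r; apply: inV_ge0.
by rewrite exprS -natr1 mulrDl mul1r addrC; apply: inVM.
Qed.

Lemma inVBC c g h : inV c (g - h) -> inV c (h - g).
Proof. by rewrite -[h - g]opprB; apply: coef_geN. Qed.

Lemma inV_eq0 g : (forall c : RR, inV c g) -> g = 0.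
Proof.
move=> cg; apply: tateP => D; rewrite tcoef0; apply: val_inj.
by apply: (@val_infty _ _ v) => c; apply: cg.
Qed.

Lemma inV_tconst c (a : R) : (c%:E <= vval a)%E -> inV c (tconst n a).
Proof.
move=> ca D; rewrite tcoef_poly mcoeffC; case: eqP => _; first by rewrite mulr1.
by rewrite mulr0 vval0 leey.
Qed.

Lemma tconst_div c (a : R) g : vval a = c%:E -> inV c g -> exists h, g = tconst n a * h.
Proof.
move=> va cg.
have dE D : {d | tcoef g D = a * d} by apply: cid; apply: vring_div va (cg D).
pose h0 : pseries n R := PSeries (fun D => projT1 (dE D)).
have h0E D : scoef h0 D = projT1 (dE D) by [].
have hP : h0 \in tate_pred (v:=v) (n:=n).
  apply/asboolP => d; have /asboolP ng := valP g; have [N gN] := ng (d + c).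
  exists N => D /gN; rewrite h0E; case: (dE D) => /= x; rewrite -[scoef _ _]/(tcoef g D) => ->.
  rewrite vvalM va; case: (vval x) => [r| |]; rewrite ?leey //.
  by rewrite -EFinD !lee_fin addrC lerD2l.
exists (Sub h0 hP : tate); apply: tateP => D; rewrite tcoefCM.
by rewrite /tcoef /=; case: (dE D).
Qed.

Definition tconverges (u : nat -> tate) g := forall c : RR,
  exists N, forall i, (N <= i)%N -> inV c (u i - g).

(** Nothing is lost in the limit: for each [D] it suffices to approximate to the precision [om D]
    required there. *)
Lemma tconverges_coef_ge om u g N : tconverges u g ->
  (forall i, (N <= i)%N -> coef_ge om (u i)) -> coef_ge om g.
Proof.
move=> ug ou D; have [M uM] := ug (om D).
rewrite -[g](subKr (u (M + N)%N)) tcoefB; apply: vvalB_ge.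
  by apply: ou; rewrite leq_addl.
by apply: uM; rewrite leq_addr.
Qed.

Hypothesis v_complete : forall u, cauchy v u -> exists l, converges v u l.

(** In the ultrametric setting small successive differences already give a Cauchy sequence. The
    limit is taken coefficientwise, but uniformly in [D], so its coefficients still tend to 0. *)
Lemma tate_complete (u : nat -> tate) :
  (forall c : RR, exists N, forall i, (N <= i)%N -> inV c (u i.+1 - u i)) ->
  exists g, tconverges u g.
Proof.
move=> uS.
have cu c : exists N, forall i j, (N <= i)%N -> (N <= j)%N -> inV c (u i - u j).
  have [N uN] := uS c; exists N.
  have le i k : (N <= i)%N -> inV c (u (i + k)%N - u i).
    move=> Ni; elim: k => [|k IH]; first by rewrite addn0 subrr; apply: coef_ge0.
    rewrite addnS -(subrKA (u (i + k)%N)); apply: coef_geD IH.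
    by apply: uN; rewrite (leq_trans Ni) ?leq_addr.
  move=> i j Ni Nj; case/orP: (leq_total i j) => ij.
    by apply: inVBC; rewrite -(subnKC ij); apply: le.
  by rewrite -(subnKC ij); apply: le.
have lim D : {l : R | forall c : RR, exists N, forall i, (N <= i)%N ->
    (c%:E <= vval (tcoef (u i) D - l)%R)%E}.
  apply: cid; have [] := @v_complete (fun i => val (tcoef (u i) D)).
    move=> c; have [N uN] := cu c; exists N => i j Ni Nj.
    by have := uN i j Ni Nj D; rewrite tcoefB /vval raddfB.
  move=> l ul; have [N uN] := ul 0.
  have lP : l \in vint v.
    rewrite inE -[l](subKr (val (tcoef (u N) D))); apply: valB_ge.
      exact: vval_ge0.
    exact: uN.
  exists (Sub l lP : R) => c; have [M uM] := ul c; exists M => i Mi.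
  by rewrite /vval raddfB; apply: uM.
pose g0 : pseries n R := PSeries (fun D => projT1 (lim D)).
have ug0 c : exists N, forall i, (N <= i)%N ->
    forall D, (c%:E <= vval (tcoef (u i) D - scoef g0 D)%R)%E.
  have [N uN] := cu c; exists N => i Ni D.
  rewrite /g0 /=; case: (lim D) => l /= ul; have [M uM] := ul c.
  rewrite -(subrKA (tcoef (u (M + N)%N) D)); apply: Defs.valD_ge.
    by rewrite -tcoefB; apply: uN; rewrite ?leq_addl.
  by apply: uM; rewrite leq_addr.
have gP : g0 \in tate_pred (v:=v) (n:=n).
  apply/asboolP => c; have [N uN] := ug0 c.
  have /asboolP/(_ c)[M uM] := valP (u N); exists M => D MD.
  rewrite -[scoef g0 D](subKr (tcoef (u N) D)); apply: vvalB_ge; first exact: uM.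
  exact: uN.
exists (Sub g0 gP : tate) => c; have [N uN] := ug0 c.
by exists N => i Ni D; rewrite tcoefB; apply: uN.
Qed.

End TateBounds.

(** * Taylor expansion *)

Section Taylor.
Variables (m : nat) (B : comNzRingType).
Implicit Types (y z h d : 'I_m -> B) (J L : 'X_{1..m}).

Lemma mnm_ind (Q : 'X_{1..m} -> Prop) :
  Q 0%MM -> (forall J j, Q J -> Q (J + U_(j))%MM) -> forall J, Q J.
Proof.
move=> Q0 QS J; move def_d: (mdeg J) => d; elim: d J def_d => [|d IH] J dJ.
  by move/eqP: dJ; rewrite mdeg_eq0 => /eqP ->.
have [j Jj] : exists j, J j != 0%N.
  apply/existsP; move: dJ; apply: contra_eqT => /existsPn J0.
  by rewrite mdegE big1 // => i _; have /negbNE/eqP := J0 i.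
have UJ : (U_(j) <= J)%MM by rewrite lep1mP.
rewrite -(submK UJ); apply/QS/IH.
by have := mdegD (J - U_(j)) U_(j); rewrite submK // dJ mdeg1 addn1 => -[].
Qed.

Lemma mmap1D z J L : mmap1 z (J + L) = mmap1 z J * mmap1 z L.
Proof. by rewrite /mmap1 -big_split; apply: eq_bigr => i _; rewrite mnmDE exprD. Qed.

(** Sums of monomials [z^(J-L) h^L] with [|L| >= k]; the impredicative form turns
    a bound on each monomial into a bound on the sum. *)
Definition mixed_span z h (k : nat) J (x : B) := forall Q : B -> Prop,
  Q 0 -> (forall a b, Q a -> Q b -> Q (a + b)) ->
  (forall L, (L <= J)%MM -> (k <= mdeg L)%N -> Q (mmap1 z (J - L) * mmap1 h L)) ->
  Q x.

Lemma mixed_span0 z h k J : mixed_span z h k J 0.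
Proof. by []. Qed.

Lemma mixed_spanD z h k J (x y : B) :
  mixed_span z h k J x -> mixed_span z h k J y -> mixed_span z h k J (x + y).
Proof. by move=> xP yP Q Q0 QD QL; apply: (QD); [exact: xP|exact: yP]. Qed.

Lemma mixed_span_base z h k J L : (L <= J)%MM -> (k <= mdeg L)%N ->
  mixed_span z h k J (mmap1 z (J - L) * mmap1 h L).
Proof. by move=> LJ kL Q _ _; apply. Qed.

Lemma mixed_spanMl z h k J j x :
  mixed_span z h k J x -> mixed_span z h k (J + U_(j)) (z j * x).
Proof.
move=> xP Q Q0 QD QL; apply: (xP (fun x => Q (z j * x))) => [|a b|L LJ kL].
- by rewrite mulr0.
- by rewrite mulrDr; apply: QD.
have -> : z j * (mmap1 z (J - L) * mmap1 h L) = mmap1 z (J + U_(j) - L) * mmap1 h L.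
  by rewrite [(J + _)%MM]addmC -addmBA // mmap1D mmap1U mulrA.
by apply: QL => //; apply: lepm_trans LJ (lem_addr _ _).
Qed.

Lemma mixed_spanMr z h k J j x :
  mixed_span z h k J x -> mixed_span z h k.+1 (J + U_(j)) (h j * x).
Proof.
move=> xP Q Q0 QD QL; apply: (xP (fun x => Q (h j * x))) => [|a b|L LJ kL].
- by rewrite mulr0.
- by rewrite mulrDr; apply: QD.
have -> : h j * (mmap1 z (J - L) * mmap1 h L)
    = mmap1 z (J + U_(j) - (L + U_(j))) * mmap1 h (L + U_(j)).
  have -> : (J + U_(j) - (L + U_(j)) = J - L)%MM.
    by apply/mnmP => i; rewrite !mnmE subnDr.
  by rewrite mmap1D mmap1U mulrCA [h j * _]mulrC.
apply: QL; last by rewrite mdegD mdeg1 addn1.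
by apply/mnm_lepP => i; rewrite !mnmDE leq_add2r; apply/mnm_lepP.
Qed.

Lemma mixed_span_le z h k k' J x : (k' <= k)%N ->
  mixed_span z h k J x -> mixed_span z h k' J x.
Proof.
move=> kk xP Q Q0 QD QL; apply: xP => // L LJ kL.
by apply: QL => //; apply: leq_trans kL.
Qed.

(** The Leibniz rule, with [d i] in the role of the differential of [y i]. The truncated subtraction
    [J - U_(i)] is harmless: its multiplicity [J i] vanishes when [i] does not occur in [J]. *)
Lemma sum_mmap1_deriv y d J j :
  \sum_i (mmap1 y (J + U_(j) - U_(i)) *+ (J + U_(j))%MM i) * d i
  = y j * (\sum_i (mmap1 y (J - U_(i)) *+ J i) * d i) + mmap1 y J * d j.
Proof.
rewrite mulr_sumr [in RHS](bigD1 j) //= [in LHS](bigD1 j) //= addrAC; congr (_ + _).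
  rewrite addmK mnmDE mnm1E eqxx addn1 mulrSr mulrDl; congr (_ + _).
  rewrite mulrA mulrnAr; case Jj: (J j) => [|a]; first by rewrite !mulr0n.
  rewrite -(mmap1U y j) -mmap1D addmC submK // lep1mP Jj //.
apply: eq_bigr => i ij; rewrite mulrA mulrnAr -(mmap1U y j) -mmap1D.
rewrite mnmDE mnm1E (eq_sym j) (negPf ij) addn0.
case Ji: (J i) => [|a]; first by rewrite !mulr0n.
by rewrite [(J + _)%MM]addmC addmBA // lep1mP Ji.
Qed.

(** Multiplying in one variable at a time keeps the remainder a plain sum of mixed monomials:
    binomial coefficients appear only as repetitions, which cannot worsen an ultrametric bound. *)
Lemma mmap1_taylor1 z h J :
  mixed_span z h 1 J (mmap1 (fun i => z i + h i) J - mmap1 z J).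
Proof.
elim/mnm_ind: J => [|J j IH]; first by rewrite !mmap11 subrr; apply: mixed_span0.
rewrite !mmap1D !mmap1U; set a := mmap1 _ J; set b := mmap1 _ J.
have -> : a * (z j + h j) - b * z j = z j * (a - b) + h j * (a - b) + h j * b by ring.
apply: mixed_spanD; first apply: mixed_spanD.
- exact: mixed_spanMl.
- by apply: (@mixed_span_le z h 2 1) => //; apply: mixed_spanMr.
have -> : b = mmap1 z (J - 0) * mmap1 h 0%MM by rewrite subm0 mmap11 mulr1.
apply: mixed_spanMr.
by apply: (@mixed_span_base z h 0 J 0%MM) => //; apply/mnm_lepP => i; rewrite mnm0E.
Qed.

Lemma mmap1_taylor2 z h J :
  mixed_span z h 2 J (mmap1 (fun i => z i + h i) J - mmap1 z J
                      - \sum_i (mmap1 z (J - U_(i)) *+ J i) * h i).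
Proof.
elim/mnm_ind: J => [|J j IH].
  rewrite !mmap11 subrr big1 ?subr0; first exact: mixed_span0.
  by move=> i _; rewrite mnm0E mulr0n mul0r.
rewrite sum_mmap1_deriv !mmap1D !mmap1U.
have := @mmap1_taylor1 z h J.
set a := mmap1 _ J in IH *; set b := mmap1 _ J in IH *; set s := \sum_i _ in IH * => ab.
have -> : a * (z j + h j) - b * z j - (z j * s + b * h j)
  = z j * (a - b - s) + h j * (a - b) by ring.
by apply: mixed_spanD; [apply: mixed_spanMl|apply: mixed_spanMr].
Qed.

Variables (A : comNzRingType) (io : {rmorphism A -> B}).
Implicit Types p : {mpoly A[m]}.

Lemma mmap_sub y z p : mmap io y p - mmap io z p
  = \sum_(J <- msupp p) io p@_J * (mmap1 y J - mmap1 z J).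
Proof. by rewrite /mmap -sumrB; apply: eq_bigr => J _; rewrite mulrBr. Qed.

Lemma mmap_mderiv z p j : mmap io z (mderiv j p)
  = \sum_(J <- msupp p) io p@_J * (mmap1 z (J - U_(j)) *+ J j).
Proof.
have -> : mderiv j p = \sum_(J <- msupp p) p@_J *: ((J j)%:R *: 'X_[(J - U_(j))]).
  rewrite {1}(mpolyE p) linear_sum; apply: eq_bigr => J _ /=.
  by rewrite mderivZ mderivX.
rewrite raddf_sum; apply: eq_bigr => J _.
by rewrite /= !mmapZ mmapX rmorph_nat mulr_natl.
Qed.

Lemma mmap_taylor2 z h p :
  mmap io (fun i => z i + h i) p - mmap io z p - \sum_j mmap io z (mderiv j p) * h j
  = \sum_(J <- msupp p) io p@_J * (mmap1 (fun i => z i + h i) J - mmap1 z J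
                      - \sum_i (mmap1 z (J - U_(i)) *+ J i) * h i).
Proof.
rewrite mmap_sub; under [X in _ - X]eq_bigr do rewrite mmap_mderiv mulr_suml.
rewrite exchange_big -sumrB; apply: eq_bigr => J _.
rewrite [in RHS]mulrBr; congr (_ - _); rewrite mulr_sumr.
by apply: eq_bigr => i _; rewrite mulrA.
Qed.

End Taylor.

(** The chain rule, which yields the Jacobian matrix of the Frobenius system. *)
Lemma mderiv_mmap (n m : nat) (A T : comNzRingType)
    (io : {rmorphism A -> {mpoly T[m]}}) (y : 'I_n -> {mpoly T[m]}) (l : 'I_m)
    (f : {mpoly A[n]}) :
  (forall a, mderiv l (io a) = 0) ->
  mderiv l (mmap io y f) = \sum_i mmap io y (mderiv i f) * mderiv l (y i).
Proof.
move=> io0; under eq_bigr do rewrite mmap_mderiv mulr_suml.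
rewrite exchange_big {1}/mmap raddf_sum; apply: eq_bigr => J _ /=.
rewrite mderivM io0 mul0r add0r.
under eq_bigr do rewrite -mulrA; rewrite -mulr_sumr; congr (_ * _).
elim/mnm_ind: J => [|J j IH].
  rewrite mmap11 -(@mpolyC1 m T) mderivC big1 // => i _.
  by rewrite mnm0E mulr0n mul0r.
by rewrite sum_mmap1_deriv mmap1D mmap1U mderivM IH mulrC.
Qed.

(** * The Newton step *)

Section Affine.
Variables (RR : realType) (F : fieldType) (v : valuation RR F) (n : nat).
Local Notation tate := (tate v n).
Implicit Types (g h : tate).

Section Congruence.
Variable c : RR.
(** As all coefficients are integral, [V(c)] with [c >= 0] is an ideal, and congruence modulo it
    passes through products, determinants and polynomial evaluation. *)
Let congV g h := inV c (g - h).

Let congV_refl g : congV g g.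
Proof. by rewrite /congV subrr; apply: coef_ge0. Qed.

Let congVD g h g' h' : congV g h -> congV g' h' -> congV (g + g') (h + h').
Proof. by rewrite /congV opprD addrACA; apply: coef_geD. Qed.

Let congVM g h g' h' : congV g h -> congV g' h' -> congV (g * g') (h * h').
Proof.
move=> gh gh'; have -> : congV (g * g') (h * h') = inV c (g * (g' - h') + h' * (g - h)).
  by congr inV; ring.
by apply: coef_geD; apply: inVMl.
Qed.

Lemma inV_prod_sub (I : Type) (s : seq I) (P : pred I) (f f' : I -> tate) :
  (forall i, P i -> inV c (f i - f' i)) ->
  inV c (\prod_(i <- s | P i) f i - \prod_(i <- s | P i) f' i).
Proof. by move=> ff; apply: (big_ind2 congV). Qed.

Lemma inV_det_sub m (A B : 'M[tate]_m) :
  (forall i j, inV c (A i j - B i j)) -> inV c (\det A - \det B).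
Proof.
move=> AB; rewrite /determinant; apply: (big_ind2 congV) => // s _.
by apply: congVM => //; apply: inV_prod_sub.
Qed.

Lemma inV_eval_sub m (y z : 'cV[tate]_m) p :
  (forall i, inV c (y i 0 - z i 0)) -> inV c (evalS y p - evalS z p).
Proof.
move=> yz; rewrite /evalS mmap_sub; apply: coef_ge_sum => J _.
apply: (@inVMl _ _ _ _ c); rewrite /mmap1; apply: inV_prod_sub => i _ /=.
elim: (J i) => [|k IH]; first exact: congV_refl.
by rewrite !exprS; apply: congVM IH; apply: yz.
Qed.
End Congruence.

Variables (l : 'X_{1..n} -> RR).
Hypothesis lD : forall D E, l (D + E)%MM = l D + l E.

(** All the bounds along the iteration are of this shape for one fixed
    [l = alpha^-1 . D]: scaling [alpha] by [1 + lambda] only divides the slope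
    [k], and [V(c)] is the case [k = 0]. *)
Definition aff k t g := coef_ge (fun D => k * l D - t) g.

Lemma affM k s t u g h : s + t <= u -> aff k s g -> aff k t h -> aff k u (g * h).
Proof. by move=> stu; apply: coef_geM => D E; rewrite lD mulrDr; lra. Qed.

Lemma aff_le k s t g : s <= t -> aff k s g -> aff k t g.
Proof. by move=> st; apply: coef_ge_le => D; lra. Qed.

Lemma inV_aff c g : inV c g <-> aff 0 (- c) g.
Proof. by split; apply: coef_ge_le => D; rewrite mul0r opprK add0r. Qed.

Let l0 : l 0%MM = 0.
Proof. by have := lD 0 0; rewrite addm0; lra. Qed.

Lemma aff1 k : aff k 0 1.
Proof.
move=> D; rewrite -[1](rmorph1 (@tpoly _ _ v n)) tcoef_poly mcoeff1.
by case: eqP => [->|_]; rewrite ?l0 ?mulr0 ?subr0 ?vval0 ?leey ?vval_ge0.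
Qed.

Lemma affM0 k g h : aff k 0 g -> aff k 0 h -> aff k 0 (g * h).
Proof. by apply: affM; rewrite addr0. Qed.

Lemma affX0 k g i : aff k 0 g -> aff k 0 (g ^+ i).
Proof.
by move=> gP; elim: i => [|i IH]; [exact: aff1|rewrite exprS; exact: affM0].
Qed.

Lemma aff_mmap1 m k t (z : 'I_m -> tate) J :
  (forall i, aff k t (z i)) -> aff k ((mdeg J)%:R * t) (mmap1 z J).
Proof.
move=> zP; elim/mnm_ind: J => [|J j IH].
  by rewrite mmap11 mdeg0 mul0r; apply: aff1.
rewrite mmap1D mmap1U mdegD mdeg1; apply: affM IH (zP j).
by rewrite natrD mulrDl mul1r.
Qed.

(** [l D - x] and [y], weighted by [1] and [lam]. *)
Lemma aff_interp lam x y s g : 0 <= lam -> x - lam * y <= s ->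
  aff 1 x g -> inV y g -> aff (1 + lam)^-1 ((1 + lam)^-1 * s) g.
Proof.
move=> lam0 xys gx gy D; have lam1 : 0 < 1 + lam by lra.
rewrite -mulrBr; have [yl|ly] := leP y (l D - x).
  apply: le_trans (gx D); rewrite lee_fin ler_pdivrMl // mul1r.
  have : lam * y <= lam * (l D - x) by rewrite ler_wpM2l.
  lra.
by apply: le_trans (gy D); rewrite lee_fin ler_pdivrMl //; lra.
Qed.

Lemma aff_sign k (b : bool) : aff k 0 ((-1) ^+ b).
Proof. by case: b; [apply: coef_geN|]; exact: aff1. Qed.

Lemma aff_det k m (A : 'M[tate]_m) :
  (forall i j, aff k 0 (A i j)) -> aff k 0 (\det A).
Proof.
move=> AP; apply: coef_ge_sum => s _; apply: affM0; first exact: aff_sign.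
by elim/big_ind: _ => [|x y|i _]; [exact: aff1|exact: affM0|].
Qed.

Lemma aff_adj k m (A : 'M[tate]_m) i j :
  (forall i j, aff k 0 (A i j)) -> aff k 0 (\adj A i j).
Proof.
move=> AP; rewrite mxE; apply: affM0; first by rewrite -signr_odd; apply: aff_sign.
by apply: aff_det => i' j'; rewrite !mxE.
Qed.

Definition aff_unit k g := aff k 0 g /\ exists h, aff k 0 h /\ g * h = 1.

(** Cramer's rule: the series with [aff k 0] form a ring, so only the inverse of the determinant
    needs a bound of its own. *)
Lemma aff_invmx k m (A : 'M[tate]_m) i j : (forall i j, aff k 0 (A i j)) ->
  aff_unit k (\det A) -> aff k 0 (invmx A i j).
Proof.
move=> AP [_ [h [hP Ah]]].
have uA : \det A \is a GRing.unit by apply/unitrP; exists h; rewrite mulrC.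
rewrite /invmx unitmxE uA mxE; apply: affM0; last exact: aff_adj.
by have -> : (\det A)^-1 = h by apply: (mulrI uA); rewrite divrr.
Qed.

Lemma aff_unit_unitmx k m (A : 'M[tate]_m) : aff_unit k (\det A) -> A \in unitmx.
Proof.
by move=> [_ [h [_ Ah]]]; rewrite unitmxE; apply/unitrP; exists h; rewrite mulrC.
Qed.

Hypothesis v_complete : forall u, cauchy v u -> exists l, converges v u l.

Lemma nat_mul_big (d c : RR) : 0 < c -> exists N, forall i, (N <= i)%N -> d <= i%:R * c.
Proof.
move=> c0; exists (Num.truncn (d / c)).+1 => i Ni.
rewrite -ler_pdivrMr //; apply: le_trans (ltW (truncnS_gt _)) _.
by rewrite ler_nat.
Qed.

(** The two bounds have separate roles: [inV c] makes the geometric series converge, while [aff k 0]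
    is stable under products and limits and so passes to its sum. *)
Lemma aff_geometric k c u : 0 < c -> inV c u -> aff k 0 u ->
  exists h, aff k 0 h /\ (1 + u) * h = 1.
Proof.
move=> c0 uc uk; pose s N := \sum_(i < N) (- u) ^+ i.
have big d : exists N, forall i, (N <= i)%N -> inV d ((- u) ^+ i).
  have [N NP] := @nat_mul_big d c c0; exists N => i /NP di.
  by apply: inV_le di _; apply/inVX/coef_geN.
have [|h sh] := tate_complete v_complete (u := s).
  move=> d; have [N NP] := big d; exists N => i Ni.
  by rewrite /s big_ord_recr addrAC subrr add0r; apply: NP.
exists h; split.
  apply: (tconverges_coef_ge sh (N := 0%N)) => i _; apply: coef_ge_sum => j _.
  by apply: affX0; apply: coef_geN.
apply/eqP; rewrite -subr_eq0; apply/eqP/inV_eq0 => d.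
have [N NP] := big d; have [M sM] := sh d; pose i := (M + N)%N.
have gs j : (1 + u) * s j - 1 = - (- u) ^+ j.
  rewrite /s; elim: j => [|j IH]; first by rewrite big_ord0 mulr0 expr0 sub0r.
  rewrite big_ord_recr /= mulrDr addrAC IH exprS; ring.
have -> : (1 + u) * h - 1 = ((1 + u) * s i - 1) - (1 + u) * (s i - h) by ring.
rewrite gs; apply: coef_geB; first by apply/coef_geN/NP; rewrite leq_addl.
by apply: inVMl; apply: sM; rewrite leq_addr.
Qed.

(** The quotient of the two determinants is [1 + u] with [u] in [V(c)], which the geometric series
    inverts. *)
Lemma aff_unit_det k c m (A B : 'M[tate]_m) : 0 < c ->
  (forall i j, aff k 0 (A i j)) -> (forall i j, aff k 0 (B i j)) ->
  (forall i j, inV c (A i j - B i j)) -> aff_unit k (\det B) -> aff_unit k (\det A).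
Proof.
move=> c0 Ak Bk ABc [Bk' [h [hk Bh]]].
have Ak' : aff k 0 (\det A) by apply: aff_det.
split=> //; pose u := (\det A - \det B) * h.
have [h' [hk' uh']] : exists h', aff k 0 h' /\ (1 + u) * h' = 1.
  apply: aff_geometric c0 _ _; last by apply: affM0 => //; apply: coef_geB.
  by rewrite /u mulrC; apply/inVMl/inV_det_sub.
exists (h * h'); split; first exact: affM0.
by rewrite mulrA -uh'; congr (_ * _); rewrite /u mulrBl Bh; ring.
Qed.

End Affine.

(** * Taylor remainders at the Newton iterate *)

Section NewtonStep.
Variables (RR : realType) (F : fieldType) (v : valuation RR F) (n m : nat).
Local Notation tate := (tate v n).
Variable G : 'I_m -> {mpoly {mpoly (vring v)[n]}[m]}.

Lemma eval_taylor2 (z h : 'cV[tate]_m) p :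
  evalS (z + h) p - evalS z p - \sum_j evalS z (mderiv j p) * h j 0
  = \sum_(J <- msupp p) tpoly p@_J *
      (mmap1 (fun i => z i 0 + h i 0) J - mmap1 (fun i => z i 0) J
       - \sum_i (mmap1 (fun i => z i 0) (J - U_(i)) *+ J i) * h i 0).
Proof.
have zhE : (fun i => (z + h) i 0) = (fun i => z i 0 + h i 0).
  by apply: funext => i; rewrite mxE.
rewrite /evalS zhE.
exact: (@mmap_taylor2 m (Defs.tate v n) {mpoly (vring v)[n]} (tpoly (v:=v) (n:=n))).
Qed.

Lemma eval_mderiv_sub (y z : 'cV[tate]_m) p j :
  evalS y (mderiv j p) - evalS z (mderiv j p)
  = \sum_(J <- msupp p) tpoly p@_J *
      ((mmap1 (fun i => y i 0) (J - U_(j)) - mmap1 (fun i => z i 0) (J - U_(j))) *+ J j).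
Proof.
rewrite /evalS !mmap_mderiv -sumrB; apply: eq_bigr => J _.
by rewrite -mulrBr -mulrnBl.
Qed.

(** The correction [h] solves [G(z) + Jac_G(z) h = 0], so the constant and linear Taylor terms
    cancel. *)
Lemma Gval_newton (z : 'cV[tate]_m) i : JacG G z \in unitmx ->
  let h := newton G z - z in
  Gval G (newton G z) i 0
  = \sum_(J <- msupp (G i)) tpoly (G i)@_J *
      (mmap1 (fun i => z i 0 + h i 0) J - mmap1 (fun i => z i 0) J
       - \sum_i (mmap1 (fun i => z i 0) (J - U_(i)) *+ J i) * h i 0).
Proof.
move=> uJ h; rewrite -eval_taylor2.
have -> : z + h = newton G z by rewrite addrC subrK.
have hE : h = - (invmx (JacG G z) *m Gval G z) by rewrite /h /newton addrAC subrr add0r.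
have : (JacG G z *m h) i 0 = - Gval G z i 0.
  by rewrite hE mulmxN mulmxA mulmxV // mul1mx mxE.
rewrite !mxE => JhE.
have -> : \sum_j evalS z (mderiv j (G i)) * h j 0 = - evalS z (G i).
  by rewrite -JhE; apply: eq_bigr => j _; rewrite [JacG G z i j]mxE.
by rewrite opprK subrK.
Qed.

Variables (l : 'X_{1..n} -> RR).
Hypothesis lD : forall D E, l (D + E)%MM = l D + l E.
Hypothesis v_complete : forall u, cauchy v u -> exists l, converges v u l.

(** These numbers stand for the inner products of [beta], [gamma] and [delta i J] with [alpha^-1];
    the bounds involve the vectors in no other way. *)
Variables (beta gamma b c lam : RR) (N : nat) (d : 'I_m -> 'X_{1..m} -> RR).
Hypotheses (b_gt0 : 0 < b) (c_gt0 : 0 < c) (lam_ge0 : 0 <= lam).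
Hypothesis gamma_beta : gamma <= beta.
Hypothesis lam_bound : forall i J j L, (2 <= mdeg J <= N)%N -> (0 < J j)%N ->
  (0 < mdeg L)%N -> (L <= J - U_(j))%MM ->
  d i J + (mdeg J - mdeg L - 1)%:R * beta + (mdeg L)%:R * gamma
  <= lam * ((mdeg J - mdeg L - 1)%:R * b + (mdeg L)%:R * c).
Variable z : 'cV[tate]_m.
Hypothesis z_bd : forall i, aff l 1 beta (z i 0) /\ inV b (z i 0).
Hypothesis G_bd : forall i, aff l 1 gamma (Gval G z i 0) /\ inV c (Gval G z i 0).
Hypothesis J_bd : forall i j, aff l 1 0 (JacG G z i j).
Hypothesis J_unit : aff_unit l 1 (\det (JacG G z)).
Hypothesis G_deg : forall i J, (N < mdeg J)%N -> (G i)@_J = 0.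
Hypothesis G_coef : forall i J, (2 <= mdeg J <= N)%N -> aff l 1 (d i J) (tpoly (G i)@_J).

Let h := newton G z - z.
Let zf i := z i 0.
Let hf i := h i 0.

Lemma newton_diff_bd i : aff l 1 gamma (h i 0) /\ inV c (h i 0).
Proof.
have -> : h i 0 = - \sum_j invmx (JacG G z) i j * Gval G z j 0.
  by rewrite /h /newton addrAC subrr add0r !mxE.
split; apply: coef_geN; apply: coef_ge_sum => j _; last first.
  by apply: inVMl; case: (G_bd j).
apply: (@affM _ _ _ _ _ lD 1 0 gamma); first by rewrite add0r.
  exact: (aff_invmx lD).
by case: (G_bd j).
Qed.

Lemma newton_bd i :
  aff l 1 beta (newton G z i 0) /\ inV (Num.min b c) (newton G z i 0).
Proof.
have [hg hc] := newton_diff_bd i; have [zb zc] := z_bd i.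
have -> : newton G z i 0 = z i 0 + h i 0 by rewrite /h !mxE addrCA subrr addr0.
split; apply: coef_geD => //; first by apply: aff_le hg.
  by apply: inV_le zc; rewrite ge_min lexx.
by apply: inV_le hc; rewrite ge_min lexx orbT.
Qed.

(** [J'] will be [J] in the expansion of [G], and [J - U_(j)] in that of its Jacobian matrix. *)
Lemma term_bd i J J' L : (2 <= mdeg J <= N)%N -> (L <= J')%MM ->
  let t := tpoly (G i)@_J * (mmap1 zf (J' - L) * mmap1 hf L) in
  aff l 1 (d i J + (mdeg J' - mdeg L)%:R * beta + (mdeg L)%:R * gamma) t /\
  inV ((mdeg J' - mdeg L)%:R * b + (mdeg L)%:R * c) t.
Proof.
move=> J2 LJ t.
have dJL : (mdeg J' - mdeg L)%N = mdeg (J' - L).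
  by rewrite -{1}(submK LJ) mdegD addnK.
rewrite dJL /t; split.
  apply: (affM lD _ (G_coef i J2)); last first.
    apply: (affM lD (lexx _)); apply: (aff_mmap1 lD) => k.
      exact: (proj1 (z_bd k)).
    exact: (proj1 (newton_diff_bd k)).
  by rewrite addrA.
apply: inVMl; apply: inVM.
  apply/(inV_aff l); rewrite -mulrN; apply: (aff_mmap1 lD) => k.
  by apply/inV_aff; case: (z_bd k).
apply/(inV_aff l); rewrite -mulrN; apply: (aff_mmap1 lD) => k.
by apply/inV_aff; case: (newton_diff_bd k).
Qed.

Lemma Gval_newton_bd i :
  inV (2 * c) (Gval G (newton G z) i 0) /\
  forall g, (forall J L, (2 <= mdeg J <= N)%N -> (L <= J)%MM -> (2 <= mdeg L)%N ->
      d i J + (mdeg J - mdeg L)%:R * beta + (mdeg L)%:R * gamma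
      - lam * ((mdeg J - mdeg L)%:R * b + (mdeg L)%:R * c) <= g) ->
    aff l (1 + lam)^-1 ((1 + lam)^-1 * g) (Gval G (newton G z) i 0).
Proof.
rewrite (Gval_newton i (aff_unit_unitmx J_unit)) -/h.
(* A property stable under addition need only be checked on mixed monomials. This serves both for
   [V(2c)], where [|L| >= 2] produces the doubling, and for the new slope. *)
have key (Q : tate -> Prop) : Q 0 -> (forall x y, Q x -> Q y -> Q (x + y)) ->
  (forall J L, (2 <= mdeg J <= N)%N -> (L <= J)%MM -> (2 <= mdeg L)%N ->
     Q (tpoly (G i)@_J * (mmap1 zf (J - L) * mmap1 hf L))) ->
  Q (\sum_(J <- msupp (G i)) tpoly (G i)@_J *
      (mmap1 (fun i => z i 0 + h i 0) J - mmap1 (fun i => z i 0) J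
       - \sum_i (mmap1 (fun i => z i 0) (J - U_(i)) *+ J i) * h i 0)).
  move=> Q0 QD QP; elim/big_ind: _ => // J _.
  have [/(G_deg i) ->|JN] := ltnP N (mdeg J); first by rewrite raddf0 mul0r.
  apply: (@mmap1_taylor2 _ _ zf hf J (fun x => Q (tpoly (G i)@_J * x))).
  - by rewrite mulr0.
  - by move=> x y; rewrite mulrDr; apply: QD.
  move=> L LJ L2; apply: QP => //; rewrite JN andbT (leq_trans L2) //.
  by rewrite -(submK LJ) mdegD leq_addl.
split=> [|g gP]; (apply: key; first exact: coef_ge0); first exact: coef_geD.
- move=> J L J2 LJ L2; have [_] := term_bd i J2 LJ; apply: inV_le.
  have L2' : 2 <= (mdeg L)%:R :> RR by rewrite (ler_nat _ 2).
  have : 2 * c <= (mdeg L)%:R * c by rewrite ler_wpM2r // ltW.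
  have : 0 <= (mdeg J - mdeg L)%:R * b by rewrite mulr_ge0 // ltW.
  lra.
- exact: coef_geD.
move=> J L J2 LJ L2; have [tx ty] := term_bd i J2 LJ.
by apply: aff_interp lam_ge0 (gP J L J2 LJ L2) tx ty.
Qed.

Lemma JacG_newton_sub_bd i j :
  inV c (JacG G (newton G z) i j - JacG G z i j) /\
  aff l (1 + lam)^-1 0 (JacG G (newton G z) i j - JacG G z i j).
Proof.
have zhE : (fun i => newton G z i 0) = (fun i => zf i + hf i).
  by apply: funext => k; rewrite /zf /hf /h !mxE addrCA subrr addr0.
have key (Q : tate -> Prop) : Q 0 -> (forall x y, Q x -> Q y -> Q (x + y)) ->
  (forall J L, (2 <= mdeg J <= N)%N -> (0 < J j)%N -> (L <= J - U_(j))%MM ->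
     (0 < mdeg L)%N -> Q (tpoly (G i)@_J * (mmap1 zf (J - U_(j) - L) * mmap1 hf L))) ->
  Q (JacG G (newton G z) i j - JacG G z i j).
  move=> Q0 QD QP; rewrite !mxE eval_mderiv_sub zhE; elim/big_ind: _ => // J _.
  have [/(G_deg i) ->|JN] := ltnP N (mdeg J); first by rewrite raddf0 mul0r.
  case Jj: (J j) => [|a]; first by rewrite mulr0n mulr0.
  (* The multiplicity [J j] created by differentiation is handled as a repeated sum. *)
  rewrite -Jj mulrnAr; elim: (J j) => [|k IH]; first by rewrite mulr0n.
  rewrite mulrS; apply: (QD) => //.
  apply: (@mmap1_taylor1 _ _ zf hf (J - U_(j)) (fun x => Q (tpoly (G i)@_J * x))).
  - by rewrite mulr0.
  - by move=> x y; rewrite mulrDr; apply: QD.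
  move=> L LJ L1; apply: QP; rewrite ?Jj // JN andbT.
  have UJ : (U_(j) <= J)%MM by rewrite lep1mP Jj.
  rewrite -(submK UJ) mdegD mdeg1 addn1 ltnS (leq_trans L1) //.
  by rewrite -(submK LJ) mdegD leq_addl.
have degJ (J : 'X_{1..m}) : (0 < J j)%N -> mdeg (J - U_(j)) = (mdeg J).-1.
  move=> Jj; have UJ : (U_(j) <= J)%MM by rewrite lep1mP -lt0n.
  by rewrite -[in RHS](submK UJ) mdegD mdeg1 addn1.
split; (apply: key; [exact: coef_ge0|exact: coef_geD|]) => J L J2 Jj LJ L1.
  have [_] := term_bd i J2 LJ; apply: inV_le.
  have L1' : 1 <= (mdeg L)%:R :> RR by rewrite (ler_nat _ 1).
  have : 1 * c <= (mdeg L)%:R * c by rewrite ler_wpM2r // ltW.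
  have : 0 <= (mdeg (J - U_(j)) - mdeg L)%:R * b by rewrite mulr_ge0 // ltW.
  lra.
(* Once [U_(j)] is removed, the exponents are those of a fraction in [lambda], so [lam_bound] brings
   the interpolated constant down to 0. *)
have [] := term_bd i J2 LJ; rewrite degJ // -subn1 subnAC => tx ty.
rewrite -[0](mulr0 (1 + lam)^-1); apply: aff_interp lam_ge0 _ tx ty.
by have := lam_bound i J2 Jj L1 LJ; lra.
Qed.

(** A smaller slope weakens the bound only where [l D] is nonnegative; elsewhere the integrality of
    the coefficients takes over. *)
Lemma aff_shrink (g : tate) : aff l 1 0 g -> aff l (1 + lam)^-1 0 g.
Proof.
move=> g0; have := aff_interp lam_ge0 (lexx _) g0 (inV_ge0 g).
by rewrite mulr0 subr0 mulr0.
Qed.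

Lemma JacG_newton_bd :
  (forall i j, aff l (1 + lam)^-1 0 (JacG G (newton G z) i j)) /\
  aff_unit l (1 + lam)^-1 (\det (JacG G (newton G z))).
Proof.
have J_bd' i j : aff l (1 + lam)^-1 0 (JacG G z i j).
  exact: aff_shrink.
have JP i j : aff l (1 + lam)^-1 0 (JacG G (newton G z) i j).
  rewrite -[JacG G (newton G z) i j](subrK (JacG G z i j)); apply: coef_geD.
    by case: (JacG_newton_sub_bd i j).
  exact: J_bd'.
split; first exact: JP.
apply: (aff_unit_det lD v_complete c_gt0 JP J_bd').
  by move=> i j; case: (JacG_newton_sub_bd i j).
case: J_unit => [gP [g [gk Jg]]].
by split; [exact: aff_shrink|exists g; split=> //; exact: aff_shrink].
Qed.

End NewtonStep.

(** * Estimates along the iteration *)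

Section Weights.
Variables (RR : realType) (n : nat).
Implicit Types al a b : 'rV[RR]_n.

Lemma wtD al a b : wt al (a + b) = wt al a + wt al b.
Proof. by rewrite /wt -big_split; apply: eq_bigr => i _; rewrite mxE mulrDr. Qed.

Lemma wtZ al k a : wt al (k *: a) = k * wt al a.
Proof. by rewrite /wt mulr_sumr; apply: eq_bigr => i _; rewrite mxE mulrCA. Qed.

Lemma wtB al a b : wt al (a - b) = wt al a - wt al b.
Proof. by rewrite -scaleN1r wtD wtZ mulN1r. Qed.

Lemma wt0 al : wt al (0 : 'rV[RR]_n) = 0.
Proof. by rewrite -(scale0r 0) wtZ mul0r. Qed.

Lemma wtZl k al a : wt (k *: al) a = k^-1 * wt al a.
Proof.
by rewrite /wt mulr_sumr; apply: eq_bigr => i _; rewrite mxE invfM mulrA.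
Qed.

Definition mwt al (D : 'X_{1..n}) : RR := wt al (mvec RR D).

Lemma mwtD al D E : mwt al (D + E)%MM = mwt al D + mwt al E.
Proof.
by rewrite /mwt -wtD; congr wt; apply/rowP => i; rewrite !mxE mnmDE natrD.
Qed.

(** Several vectors ([beta'], [gamma'], and [delta] at the starting point) are prescribed only
    through their weight; concentrating it in the first coordinate provides one. *)
Lemma wt_surj al x : (0 < n)%N -> (forall i, 0 < al 0 i) -> exists a, wt al a = x.
Proof.
case: n al => // n' al _ al0; exists (\row_i if i == 0 then x * al 0 0 else 0).
rewrite /wt big_ord_recl mxE eqxx big1 ?addr0; last first.
  by move=> i _; rewrite mxE mulr0.
by rewrite mulrC mulfK // gt_eqF.
Qed.

Variables (F : fieldType) (v : valuation RR F).

Lemma inW_aff al a (g : tate v n) : inW al a g <-> aff (mwt al) 1 (wt al a) g.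
Proof. by split=> gP D; move: (gP D); rewrite wtB mul1r. Qed.

Lemma inW_affZ k al a (g : tate v n) :
  inW (k *: al) a g <-> aff (mwt al) k^-1 (k^-1 * wt al a) g.
Proof. by split=> gP D; move: (gP D); rewrite wtZl wtB mulrBr. Qed.

Lemma W0unit_aff al (g : tate v n) : W0unit al g <-> aff_unit (mwt al) 1 g.
Proof.
split=> -[gP [h [hP gh]]]; (split; [|exists h; split=> //]);
by move: gP hP; rewrite !inW_aff wt0.
Qed.

Lemma W0unit_affZ k al (g : tate v n) :
  W0unit (k *: al) g <-> aff_unit (mwt al) k^-1 g.
Proof.
split=> -[gP [h [hP gh]]]; (split; [|exists h; split=> //]);
by move: gP hP; rewrite !inW_affZ wt0 mulr0.
Qed.

Lemma inW_widen k al a (g : tate v n) : 1 <= k -> inW al a g -> inW (k *: al) a g.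
Proof.
move=> k1; rewrite inW_aff inW_affZ => ga.
have k10 : 0 <= k - 1 by rewrite subr_ge0.
rewrite -(subrKC 1 k); apply: aff_interp k10 _ ga (inV_ge0 g).
by rewrite mulr0 subr0.
Qed.

Lemma inW_le al a b (g : tate v n) : wt al a <= wt al b -> inW al a g -> inW al b g.
Proof. by move=> ab /inW_aff ga; apply/inW_aff; apply: aff_le ga. Qed.

End Weights.

(** * Evolution of the constants: [lambda], [b], [beta] and [gamma] *)

Section BoundsStep.
Variables (RR : realType) (n m N : nat).
Variable delta : 'I_m -> 'X_{1..m} -> 'rV[RR]_n.
Local Notation bounds := (bounds RR n).
Implicit Types (P Q : bounds) (J L : 'X_{1..m}).
Local Notation lambda := (lambda N delta).
Local Notation step := (bounds_step N delta).

Definition pos_bounds P := [/\ forall i, 0 < b_alpha P 0 i, 0 < b_b P & 0 < b_c P].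

Local Notation wtP P := (wt (b_alpha P)).

Definition lambda_num P i (J L : 'X_{1..m}) := wtP P (delta i J)
  + (mdeg J - mdeg L - 1)%:R * wtP P (b_beta P) + (mdeg L)%:R * wtP P (b_gamma P).
Definition lambda_den P (J L : 'X_{1..m}) : RR :=
  (mdeg J - mdeg L - 1)%:R * b_b P + (mdeg L)%:R * b_c P.

Lemma lambda_den_gec P J L : pos_bounds P -> (0 < mdeg L)%N ->
  b_c P <= lambda_den P J L.
Proof.
move=> [_ b0 c0] L1; rewrite /lambda_den.
have : 0 <= (mdeg J - mdeg L - 1)%:R * b_b P by rewrite mulr_ge0 // ltW.
have : 1 * b_c P <= (mdeg L)%:R * b_c P by rewrite ler_wpM2r ?(ler_nat _ 1) // ltW.
lra.
Qed.

Lemma lambda_den_gt0 P J L : pos_bounds P -> (0 < mdeg L)%N -> 0 < lambda_den P J L.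
Proof.
by move=> P0 L1; apply: lt_le_trans (lambda_den_gec J P0 L1); case: P0.
Qed.

Lemma lambda_ge0 P : 0 <= lambda P.
Proof. exact: bigmax_ge_id. Qed.

Lemma mdeg_lt_subU (J L : 'X_{1..m}) j : (0 < J j)%N -> (L <= J - U_(j))%MM ->
  (mdeg L < mdeg J)%N.
Proof.
move=> Jj LJ; have UJ : (U_(j) <= J)%MM by rewrite lep1mP -lt0n.
by rewrite -(submK UJ) mdegD mdeg1 addn1 ltnS -(submK LJ) mdegD leq_addl.
Qed.

Lemma lambda_ub P i J j L : pos_bounds P -> (2 <= mdeg J <= N)%N -> (0 < J j)%N ->
  (0 < mdeg L)%N -> (L <= J - U_(j))%MM ->
  lambda_num P i J L <= lambda P * lambda_den P J L.
Proof.
move=> P0 /andP[J2 JN] Jj L1 LJ; rewrite -ler_pdivrMr; last exact: lambda_den_gt0.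
have JN' : (mdeg J < N.+1)%N by [].
have LN' : (mdeg L < N.+1)%N.
  by rewrite ltnS; apply: leq_trans (ltnW (mdeg_lt_subU Jj LJ)) JN.
apply: (@bigmax_sup _ _ _ _ i) => //; apply: (@bigmax_sup _ _ _ _ j) => //.
apply: (@bigmax_sup _ _ _ _ (BMultinom JN')); first by rewrite J2.
apply: (@bigmax_sup _ _ _ _ (BMultinom LN')); first by rewrite L1.
by rewrite /= !wtD !wtZ.
Qed.

Lemma lambda_le P x : pos_bounds P -> 0 <= x ->
  (forall i J j L, (2 <= mdeg J <= N)%N -> (0 < J j)%N -> (0 < mdeg L)%N ->
     (L <= J - U_(j))%MM -> lambda_num P i J L <= x * lambda_den P J L) ->
  lambda P <= x.
Proof.
move=> P0 x0 H; apply: bigmax_le => // i _; apply: bigmax_le => // j _.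
apply: bigmax_le => // J /andP[J2 Jj]; apply: bigmax_le => // L /andP[L1 LJ].
rewrite !wtD !wtZ ler_pdivrMr; last exact: lambda_den_gt0.
by apply: H Jj L1 LJ; rewrite J2 -ltnS bmdeg.
Qed.

Lemma step_pos P Q : pos_bounds P -> step P Q -> pos_bounds Q.
Proof.
move=> [a0 b0 c0] [bQ cQ aQ _ _]; split; last by rewrite cQ mulr_gt0.
  move=> i; rewrite aQ !mxE ltr_pwDl // mulr_ge0 ?lambda_ge0 // ltW //.
by rewrite bQ lt_min b0.
Qed.

Lemma step_alpha P Q : step P Q -> b_alpha Q = (1 + lambda P) *: b_alpha P.
Proof. by case=> _ _ -> _ _; rewrite scalerDl scale1r. Qed.

(** Lowering [L] at one index [j] turns the expression defining [gamma'] into a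
    competitor for [lambda], plus one factor bounded by [gamma] and [c]. *)
Lemma gamma_value_le P y : pos_bounds P -> gamma_value N delta P y ->
  y <= wtP P (b_gamma P) - lambda P * b_c P.
Proof.
move=> P0 [i [J [L [J2 LJ L2 ->]]]].
have [j Lj] : exists j, (0 < L j)%N.
  apply/existsP; move: L2; apply: contraLR => /existsPn L0.
  by rewrite mdegE big1 // => j _; apply/eqP; rewrite -leqn0 leqNgt.
have UL : (U_(j) <= L)%MM by rewrite lep1mP -lt0n.
have Jj : (0 < J j)%N by apply: leq_trans Lj _; apply/mnm_lepP.
have dL : mdeg L = (mdeg (L - U_(j))).+1 by rewrite -{1}(submK UL) mdegD mdeg1 addn1.
have LJ' : (L - U_(j) <= J - U_(j))%MM.
  by apply/mnm_lepP => k; rewrite !mnmBE leq_sub2r //; apply/mnm_lepP.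
have := lambda_ub i P0 J2 Jj (_ : 0 < mdeg (L - U_(j)))%N LJ'.
rewrite -ltnS -dL => /(_ L2); rewrite /lambda_num /lambda_den.
have -> : (mdeg J - mdeg (L - U_(j)) - 1 = mdeg J - mdeg L)%N by rewrite dL; lia.
rewrite !wtD !wtZ dL -natr1; set x := _%:R; set y' := _%:R; set lam := lambda P.
nra.
Qed.

Lemma step_gamma P Q : pos_bounds P -> step P Q ->
  wtP P (b_gamma Q) <= wtP P (b_gamma P) - lambda P * b_c P.
Proof. by move=> P0 [_ _ _ _ [gQ _]]; apply: gamma_value_le. Qed.

(** The weight of [gamma] drops by at least [lambda * c] and that of [beta] only by [lambda * b'],
    where [b' <= c]. *)
Lemma step_gamma_beta P Q : pos_bounds P -> step P Q ->
  wtP P (b_gamma P) <= wtP P (b_beta P) -> wtP Q (b_gamma Q) <= wtP Q (b_beta Q).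
Proof.
move=> P0 PQ gb; have gQ := step_gamma P0 PQ; have l0 := lambda_ge0 P.
rewrite (step_alpha PQ) !wtZl ler_wpM2l ?invr_ge0 ?addr_ge0 //.
case: PQ => bQ _ _ -> _; apply: le_trans gQ _; apply: lerB => //.
by rewrite ler_wpM2l // bQ ge_min lexx orbT.
Qed.

(** The factor [1 + lambda P] undoes the rescaling of the weights by the new [alpha]. What is
    subtracted collects the loss [lambda * b'] for each [beta] and at least [lambda * c] for each
    [gamma]. *)
Lemma lambda_num_step P Q i J j L : pos_bounds P -> step P Q ->
  (0 < J j)%N -> (0 < mdeg L)%N -> (L <= J - U_(j))%MM ->
  (1 + lambda P) * lambda_num Q i J L <= lambda_num P i J L
    - lambda P * ((mdeg J - mdeg L - 1)%:R * b_b Q + (mdeg L)%:R * b_c P).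
Proof.
move=> P0 PQ Jj L1 LJ; have l0 := lambda_ge0 P.
have gQ := step_gamma P0 PQ.
rewrite /lambda_num (step_alpha PQ) !wtZl; have [_ _ _ -> _] := PQ.
set k := (1 + _); have k0 : k != 0 by rewrite gt_eqF // /k ltr_pwDl.
have -> : k * (k^-1 * wtP P (delta i J)
   + (mdeg J - mdeg L - 1)%:R * (k^-1 * (wtP P (b_beta P) - lambda P * b_b Q))
   + (mdeg L)%:R * (k^-1 * wtP P (b_gamma Q)))
  = wtP P (delta i J) + (mdeg J - mdeg L - 1)%:R * (wtP P (b_beta P) - lambda P * b_b Q)
   + (mdeg L)%:R * wtP P (b_gamma Q) by field.
have : (mdeg L)%:R * wtP P (b_gamma Q)
   <= (mdeg L)%:R * (wtP P (b_gamma P) - lambda P * b_c P) by rewrite ler_wpM2l.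
lra.
Qed.

(** When [b] is unchanged, the loss in each numerator is exactly [lambda] times the old denominator,
    hence at least the old numerator; the new numerators are nonpositive. *)
Lemma lambda_stable P Q : pos_bounds P -> step P Q -> b_b Q = b_b P -> lambda Q = 0.
Proof.
move=> P0 PQ bQ; apply/eqP; rewrite eq_le lambda_ge0 andbT.
have l0 := lambda_ge0 P.
apply: lambda_le => //; first exact: step_pos PQ.
move=> i J j L J2 Jj L1 LJ; rewrite mul0r.
have k0 : 0 < 1 + lambda P by rewrite ltr_pwDl.
rewrite -(pmulr_rle0 _ k0); apply: le_trans (lambda_num_step i P0 PQ Jj L1 LJ) _.
by rewrite bQ subr_le0; apply: lambda_ub Jj L1 LJ.
Qed.

Lemma step_b_stable P Q T : step P Q -> step Q T -> b_b Q = b_b P -> pos_bounds P ->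
  b_b T = b_b Q.
Proof.
move=> [bQ cQ _ _ _] [bT _ _ _ _] QP [_ _ c0]; rewrite bT cQ; apply/min_idPl.
by rewrite bQ; apply: (@le_trans _ _ (b_c P)); rewrite ?ge_min ?lexx ?orbT //; lra.
Qed.

Lemma step_same_W P Q T : pos_bounds P -> step P Q -> b_b Q = b_b P -> step Q T ->
  same_W Q T.
Proof.
move=> P0 PQ QP QT; have l0 := lambda_stable P0 PQ QP.
have bT := step_b_stable PQ QT QP P0; case: QT => _ _ aT wT _.
by split=> //; rewrite ?wT ?aT l0 ?scale0r ?addr0 ?mul0r ?subr0.
Qed.

Lemma same_W_trans P Q T : same_W P Q -> same_W Q T -> same_W P T.
Proof.
by move=> [a b w] [a' b' w']; split; [rewrite a'|rewrite b'|rewrite -w -a w'].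
Qed.

Lemma chain_pos P Ps t : pos_bounds P -> bounds_chain N delta P Ps -> pos_bounds (Ps t).
Proof. by move=> P0 [Ps0 PsS]; elim: t => [|t IH]; [rewrite Ps0|exact: step_pos (PsS t)]. Qed.

Lemma chain_same_W P Ps a : pos_bounds P -> bounds_chain N delta P Ps ->
  b_b (Ps a.+1) = b_b (Ps a) -> forall t, (a.+1 <= t)%N -> same_W (Ps a.+1) (Ps t).
Proof.
move=> P0 ch ba; have [_ PsS] := ch.
have bS t : (a <= t)%N -> b_b (Ps t.+1) = b_b (Ps t).
  elim: t => [|t IH]; first by rewrite leqn0 => /eqP a0; rewrite -a0.
  rewrite leq_eqVlt => /orP[/eqP <- //|]; rewrite ltnS => ta.
  exact: step_b_stable (PsS t) (PsS t.+1) (IH ta) (chain_pos t P0 ch).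
elim=> // t IH; rewrite leq_eqVlt => /orP[/eqP <-|]; first by split.
rewrite ltnS => ta; apply: same_W_trans (IH ta) _.
case: t ta {IH} => // t; rewrite ltnS => ta.
exact: step_same_W (chain_pos t P0 ch) (PsS t) (bS t ta) (PsS t.+1).
Qed.

(** After one step [b] is at most the old [c], while the new [c] is twice as large. This is why the
    estimates settle at the second iterate. *)
Lemma chain_b2 P Ps : pos_bounds P -> bounds_chain N delta P Ps ->
  b_b (Ps 2%N) = b_b (Ps 1%N).
Proof.
move=> [_ _ c0] [Ps0 PsS]; have [b2 _ _ _ _] := PsS 1%N; have [b1 c1 _ _ _] := PsS 0%N.
rewrite b2; apply/min_idPl; rewrite c1 b1 Ps0.
by apply: (@le_trans _ _ (b_c P)); rewrite ?ge_min ?lexx ?orbT //; lra.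
Qed.

Lemma chain_c P Ps t : bounds_chain N delta P Ps -> b_c (Ps t) = 2 ^+ t * b_c P.
Proof.
move=> [Ps0 PsS]; elim: t => [|t IH]; first by rewrite Ps0 mul1r.
by have [_ -> _ _ _] := PsS t; rewrite IH exprS mulrA.
Qed.

Lemma bigM_ge0 P : 0 <= bigM N delta P.
Proof. exact: bigmax_ge_id. Qed.

(** Since the weight of [gamma] is at most that of [beta], each [gamma] may be replaced by [beta],
    which makes [|J| - 1] copies of [beta] in all. *)
Lemma lambda_num_bigM P i J j L : (2 <= mdeg J <= N)%N -> (0 < J j)%N ->
  (L <= J - U_(j))%MM -> wtP P (b_gamma P) <= wtP P (b_beta P) ->
  lambda_num P i J L <= bigM N delta P.
Proof.
move=> /andP[J2 JN] Jj LJ gb; have JN' : (mdeg J < N.+1)%N by [].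
apply: (@bigmax_sup _ _ _ _ i) => //.
apply: (@bigmax_sup _ _ _ _ (BMultinom JN')) => //=.
have -> : (mdeg J).-1 = (mdeg J - mdeg L - 1 + mdeg L)%N.
  by have := mdeg_lt_subU Jj LJ; lia.
rewrite wtD wtZ natrD mulrDl addrA lerD2l ler_wpM2l //.
Qed.

Lemma lambda_le_bigM P : pos_bounds P -> wtP P (b_gamma P) <= wtP P (b_beta P) ->
  lambda P <= bigM N delta P / b_c P.
Proof.
move=> P0 gb; have [_ _ c0] := P0; have M0 := bigM_ge0 P.
apply: lambda_le => //; first by rewrite divr_ge0 // ltW.
move=> i J j L J2 Jj L1 LJ; apply: le_trans (lambda_num_bigM i J2 Jj LJ gb) _.
rewrite mulrAC ler_pdivlMr //; apply: ler_wpM2l => //.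
exact: lambda_den_gec.
Qed.

(** The second half of the estimate by [mu]: the total factor is
    [1 + lambda P + (1 + lambda P) * lambda Q], and the 2 in the denominator comes from the doubled
    [c]. *)
Lemma lambda_step_le_bigM P Q : pos_bounds P -> step P Q ->
  wtP P (b_gamma P) <= wtP P (b_beta P) ->
  (1 + lambda P) * lambda Q <= bigM N delta P / (2 * b_c P).
Proof.
move=> P0 PQ gb; have [_ b0 c0] := P0; have M0 := bigM_ge0 P.
have l0 := lambda_ge0 P; have k0 : 0 < 1 + lambda P by rewrite ltr_pwDl.
have Q0 := step_pos P0 PQ; have [_ bQ0 cQ0] := Q0.
have cQ : b_c Q = 2 * b_c P by case: PQ.
rewrite mulrC -ler_pdivlMr //; apply: lambda_le => //.
  by rewrite !divr_ge0 // ltW // mulr_gt0.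
move=> i J j L J2 Jj L1 LJ; rewrite mulrAC ler_pdivlMr // mulrC.
apply: le_trans (lambda_num_step i P0 PQ Jj L1 LJ) _.
have := lambda_num_bigM i J2 Jj LJ gb; move: (lambda_num P i J L) => num numM.
have : 0 <= lambda P * ((mdeg J - mdeg L - 1)%:R * b_b Q + (mdeg L)%:R * b_c P).
  by rewrite mulr_ge0 // addr_ge0 // mulr_ge0 // ltW.
have : bigM N delta P <= bigM N delta P / (2 * b_c P) * lambda_den Q J L.
  rewrite mulrAC ler_pdivlMr ?mulr_gt0 //; apply: ler_wpM2l => //.
  by rewrite -cQ; apply: lambda_den_gec.
lra.
Qed.

Lemma step_exists P : (0 < n)%N -> (0 < m)%N -> (2 <= N)%N -> pos_bounds P ->
  exists Q, step P Q.
Proof.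
move=> n0 m0 N2 [a0 _ _].
pose T := ('I_m * 'X_{1..m < N.+1} * 'X_{1..m < N.+1})%type.
pose ok (x : T) := [&& (2 <= mdeg x.1.2)%N, (x.2 <= x.1.2)%MM & (2 <= mdeg x.2)%N].
pose val (x : T) : RR := wtP P (delta x.1.1 x.1.2
    + (mdeg x.1.2 - mdeg x.2)%:R *: b_beta P + (mdeg x.2)%:R *: b_gamma P)
  - lambda P * ((mdeg x.1.2 - mdeg x.2)%:R * b_b P + (mdeg x.2)%:R * b_c P).
(* The maximum defining [gamma'] must range over a nonempty set; [J = L] of degree 2 in a single
   variable is always available, as [m > 0] and [N >= 2]. *)
pose i0 := Ordinal m0; have dJ0 : mdeg (U_(i0) *+ 2)%MM = 2 by rewrite mdegMn mdeg1.
have J0N : (mdeg (U_(i0) *+ 2)%MM < N.+1)%N by rewrite dJ0.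
pose x0 : T := (i0, BMultinom J0N, BMultinom J0N).
have ok0 : ok x0 by rewrite /ok /= dJ0 lepm_refl.
have [x okx xmax] := arg_maxP val ok0.
have [be beE] := wt_surj (wtP P (b_beta P) - lambda P * Num.min (b_b P) (b_c P)) n0 a0.
have [ga gaE] := wt_surj (val x) n0 a0.
exists (Bounds (b_alpha P + lambda P *: b_alpha P) be ga
          (Num.min (b_b P) (b_c P)) (2 * b_c P)).
split=> //=; rewrite gaE; split.
  case/and3P: okx => J2 LJ L2; exists x.1.1, x.1.2, x.2; split=> //.
  by rewrite J2 -ltnS bmdeg.
move=> _ [i [J [L [/andP[J2 JN] LJ L2 ->]]]].
have JN' : (mdeg J < N.+1)%N by [].
have LN' : (mdeg L < N.+1)%N.
  by apply: leq_trans JN'; rewrite ltnS -(submK LJ) mdegD leq_addl.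
apply: (xmax (i, BMultinom JN', BMultinom LN')).
by rewrite /ok /= J2 LJ.
Qed.

Lemma chain_exists P : (0 < n)%N -> (0 < m)%N -> (2 <= N)%N -> pos_bounds P ->
  exists Ps, bounds_chain N delta P Ps.
Proof.
move=> n0 m0 N2 P0.
have nxt Q : {T | pos_bounds Q -> step Q T}.
  (* Steps are only known to exist for positive bounds; elsewhere [Q] itself is a dummy value, never
     reached along the chain. *)
  apply: cid; have [Q0|nQ] := pselect (pos_bounds Q); last by exists Q.
  by have [T] := step_exists n0 m0 N2 Q0; exists T.
pose f Q := projT1 (nxt Q); have fP Q : pos_bounds Q -> step Q (f Q) := projT2 (nxt Q).
exists (fun t => iter t f P); split=> // t; apply: (fP).
by elim: t => //= t IH; apply: step_pos (fP _ IH).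
Qed.

End BoundsStep.

(** Only exponents with a positive required bound matter, by integrality; for these a larger [k]
    lowers the slope and a larger weight of [a] the constant. *)
Lemma inW_grow (RR : realType) (F : fieldType) (v : valuation RR F) (n : nat)
    (k k' : RR) (al a a' : 'rV[RR]_n) (g : tate v n) :
  0 < k' <= k -> wt al a' <= wt al a -> inW (k' *: al) a' g -> inW (k *: al) a g.
Proof.
move=> /andP[k'0 kk] aa /inW_affZ gP; apply/inW_affZ => D.
have k0 : 0 < k by apply: lt_le_trans kk.
rewrite -mulrBr; have [le0|gt0] := leP (mwt al D - wt al a) 0.
  by apply: vval_ge_npos; rewrite pmulr_rle0 // invr_gt0.
apply: le_trans (gP D); rewrite -mulrBr lee_fin; apply: ler_pM => //.
- by rewrite invr_ge0 ltW.
- exact: ltW.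
- by rewrite lef_pV2.
by rewrite lerB.
Qed.

(** * Newton iterates and their limit *)

Section NewtonEstimates.
Variables (RR : realType) (F : fieldType) (v : valuation RR F) (n m : nat).
Hypothesis v_complete : forall u, cauchy v u -> exists l, converges v u l.
Variables (G : 'I_m -> {mpoly {mpoly (vring v)[n]}[m]}) (N : nat).
Variable delta : 'I_m -> 'X_{1..m} -> 'rV[RR]_n.
Hypotheses (n_gt0 : (0 < n)%N) (m_gt0 : (0 < m)%N).
Local Notation tate := (tate v n).
Implicit Types (P Q : bounds RR n) (z s : 'cV[tate]_m).

Lemma newton_hyp_pos P z : newton_hyp G P z -> pos_bounds P.
Proof. by case. Qed.

Lemma newton_hyp_step P Q z : newton_hyp G P z -> coef_hyp G N delta (b_alpha P) ->
  bounds_step N delta P Q ->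
  newton_hyp G Q (newton G z) /\
  forall i, inV (b_c P) (newton G z i 0 - z i 0).
Proof.
move=> hP [N2 Gdeg Gcoef] PQ; have P0 := newton_hyp_pos hP.
have Q0 := step_pos P0 PQ; have l0 := lambda_ge0 N delta P.
case: hP => [[a0 b0 c0]] zP GP [JP uJ] gb.
have lD := @mwtD RR n (b_alpha P); set l := mwt (b_alpha P) in lD.
have zP' i : aff l 1 (wt (b_alpha P) (b_beta P)) (z i 0) /\ inV (b_b P) (z i 0).
  by case: (zP i) => /inW_aff.
have GP' i : aff l 1 (wt (b_alpha P) (b_gamma P)) (Gval G z i 0)
             /\ inV (b_c P) (Gval G z i 0).
  by case: (GP i) => /inW_aff.
have JP' i j : aff l 1 0 (JacG G z i j) by have /inW_aff := JP i j; rewrite wt0.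
have uJ' : aff_unit l 1 (\det (JacG G z)) by apply/W0unit_aff.
have Gc i J : (2 <= mdeg J <= N)%N -> aff l 1 (wt (b_alpha P) (delta i J)) (tpoly (G i)@_J).
  by move=> /(Gcoef i)/inW_aff.
have lub i J j L := @lambda_ub _ _ _ N delta P i J j L P0.
have aQ := step_alpha PQ; have gbQ := step_gamma_beta P0 PQ gb.
have diff i : inV (b_c P) (newton G z i 0 - z i 0).
  by have [_] := newton_diff_bd lD GP' JP' uJ' i; rewrite !mxE.
have [J1 J2] := JacG_newton_bd lD v_complete b0 c0 l0 lub zP' GP' JP' uJ' Gdeg Gc.
split; last exact: diff.
split; [exact: Q0| | | |exact: gbQ].
- move=> i; have [zb zc] := newton_bd lD gb zP' GP' JP' uJ' i.
  have [bQ cQ _ wQ _] := PQ; rewrite bQ aQ; split=> //; apply/inW_affZ.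
  by apply: aff_interp l0 _ zb zc; rewrite wQ bQ.
- move=> i; have [Gi2 Gig] := Gval_newton_bd lD b0 c0 l0 zP' GP' JP' uJ' Gdeg Gc i.
  have [bQ cQ _ _ [_ gmax]] := PQ; rewrite cQ aQ; split=> //; apply/inW_affZ.
  apply: Gig => J L dJ LJ L2; apply: gmax; exists i, J, L; split=> //.
  by rewrite !wtD !wtZ.
rewrite aQ; split; last by apply/W0unit_affZ.
by move=> i j; apply/inW_affZ; rewrite wt0 mulr0.
Qed.

Lemma coef_hyp_step P Q : coef_hyp G N delta (b_alpha P) ->
  bounds_step N delta P Q -> coef_hyp G N delta (b_alpha Q).
Proof.
move=> [N2 Gdeg Gcoef] PQ; split=> // i J J2; rewrite (step_alpha PQ).
by apply: inW_widen (Gcoef i J J2); rewrite lerDl lambda_ge0.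
Qed.

Lemma newton_step_estimateP P z : newton_hyp G P z ->
  coef_hyp G N delta (b_alpha P) -> newton_step_estimate G N delta P z.
Proof.
move=> hP cP; have P0 := newton_hyp_pos hP; split.
- by case: cP => N2 _ _; apply: step_exists.
- by move=> Q PQ; case: (newton_hyp_step hP cP PQ).
move=> Ps ch b1; apply: (chain_same_W P0 ch).
by have [-> _] := ch.
Qed.

Section Chain.
Variables (P : bounds RR n) (z : 'cV[tate]_m) (Ps : nat -> bounds RR n).
Hypotheses (hP : newton_hyp G P z) (cP : coef_hyp G N delta (b_alpha P)).
Hypothesis ch : bounds_chain N delta P Ps.
Local Notation zs t := (iter t (newton G) z).

Lemma chain_newton_hyp t :
  newton_hyp G (Ps t) (zs t) /\ coef_hyp G N delta (b_alpha (Ps t)).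
Proof.
have [Ps0 PsS] := ch; elim: t => [|t [IH1 IH2]]; first by rewrite Ps0.
split; last exact: coef_hyp_step (PsS t).
by have [] := newton_hyp_step IH1 IH2 (PsS t).
Qed.

Lemma chain_diff t i : inV (2 ^+ t * b_c P) (zs t.+1 i 0 - zs t i 0).
Proof.
have [h1 h2] := chain_newton_hyp t; rewrite -(chain_c t ch).
by have [_] := newton_hyp_step h1 h2 (ch.2 t); apply.
Qed.

Lemma chain_2W t i : (2 <= t)%N ->
  inW (b_alpha (Ps 2%N)) (b_beta (Ps 2%N)) (zs t i 0) /\ inV (b_b (Ps 2%N)) (zs t i 0).
Proof.
move=> t2; have P0 := newton_hyp_pos hP.
have [a b w] := chain_same_W P0 ch (chain_b2 P0 ch) t2.
have [[_ zt _ _ _] _] := chain_newton_hyp t; have [zW zV] := zt i.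
by rewrite -b; split=> //; rewrite -a; apply: inW_le zW; rewrite a w.
Qed.

Lemma chain_simple_W t i : inW ((1 + mu N delta P) *: b_alpha P) (b_beta P) (zs t i 0).
Proof.
have P0 := newton_hyp_pos hP; have [_ _ c0] := P0.
have gb : wt (b_alpha P) (b_gamma P) <= wt (b_alpha P) (b_beta P) by case: hP.
have M0 := bigM_ge0 N delta P; have l0 := lambda_ge0 N delta P.
have lM := lambda_le_bigM N delta P0 gb.
(* The two summands bound [lambda] at the first step and its contribution at the second. *)
have muE : mu N delta P = bigM N delta P / b_c P + bigM N delta P / (2 * b_c P).
  by rewrite /mu; field; rewrite gt_eqF.
have cM0 : 0 <= bigM N delta P / (2 * b_c P) by rewrite divr_ge0 // mulr_ge0 // ltW.
have [Ps0 PsS] := ch.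
have zW t' : inW (b_alpha (Ps t')) (b_beta (Ps t')) (zs t' i 0).
  by have [[_ /(_ i)[]]] := chain_newton_hyp t'.
have step01 := PsS 0%N; rewrite Ps0 in step01.
have [P1b _ _ P1w _] := step01; have a1 := step_alpha step01.
have [_ P1b0 _] := step_pos P0 step01.
have w1 : wt (b_alpha P) (b_beta (Ps 1%N)) <= wt (b_alpha P) (b_beta P).
  by rewrite P1w gerBl mulr_ge0 // ltW.
(* From the second iterate on, [alpha] and the weight of [beta] are constant, so three cases
   suffice. *)
case: t => [|[|t]].
- have := zW 0%N; rewrite Ps0 -[b_alpha P in X in X -> _]scale1r.
  by apply: inW_grow => //; rewrite ltr01 lerDl /=; rewrite muE; lra.
- have := zW 1%N; rewrite a1; apply: inW_grow => //.
  by rewrite muE; apply/andP; split; lra.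
have [+ _] := @chain_2W t.+2 i isT.
have l1 := lambda_step_le_bigM P0 step01 gb; have l1' := lambda_ge0 N delta (Ps 1%N).
rewrite (step_alpha (PsS 1%N)) a1 scalerA; apply: inW_grow.
  rewrite mulr_gt0 ?ltr_pwDl //= mulrDl mul1r muE.
  by move: l1; rewrite mulrDl mul1r; lra.
apply: le_trans w1; have [_ _ _ + _] := PsS 1%N.
rewrite a1 !wtZl => w2; have k0 : 0 < (1 + lambda N delta P)^-1.
  by rewrite invr_gt0 ltr_pwDl.
have [_ b2 _] := step_pos (step_pos P0 step01) (PsS 1%N).
by rewrite -(ler_pM2l k0) w2 gerBl mulr_ge0 // ltW.
Qed.

(** The corrections and the values [G(z_t)] both lie in [V(2^t c)], so the iterates converge, and by
    continuity of evaluation to a root. *)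
Lemma newton_converges : exists s, [/\ Gval G s = 0,
  forall i, inV (Num.min (b_b P) (b_c P)) (s i 0) &
  forall i, tconverges (fun t => zs t i 0) (s i 0)].
Proof.
have P0 := newton_hyp_pos hP; have [_ _ c0] := P0.
have big (d : RR) : exists M, forall t, (M <= t)%N -> d <= 2 ^+ t * b_c P.
  have [M dM] := nat_mul_big d c0; exists M => t /dM dt; apply: le_trans dt _.
  rewrite ler_wpM2r ?(ltW c0) //.
  by rewrite -natrX ler_nat ltnW // ltn_expl.
have lim i : {g | tconverges (fun t => zs t i 0) g}.
  apply: cid; apply: tate_complete => // d; have [M dM] := big d.
  by exists M => t /dM dt; apply: inV_le dt _; apply: chain_diff.
pose s : 'cV[tate]_m := \col_i projT1 (lim i).
have sP i : tconverges (fun t => zs t i 0) (s i 0) by rewrite mxE; case: (lim i).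
exists s; split=> //; last first.
  move=> i; apply: (tconverges_coef_ge (sP i) (N := 1%N)) => t t1.
  (* After the first step [b] is frozen, every later [c] being at least the original one; hence the
     limit is taken over [t >= 1]. *)
  have chb : forall t, b_b (Ps t.+1) = Num.min (b_b P) (b_c P).
    elim=> [|t' IH]; first by have [b1 _ _ _ _] := ch.2 0%N; rewrite b1 ch.1.
    have [-> _ _ _ _] := ch.2 t'.+1; rewrite IH (chain_c _ ch); apply/min_idPl.
    apply: (@le_trans _ _ (b_c P)); first by rewrite ge_min lexx orbT.
    by rewrite ler_peMl ?(ltW c0) // exprn_ege1 // (ler_nat _ 1 2).
  case: t t1 => // t _; have [[_ zt _ _ _] _] := chain_newton_hyp t.+1.
  by rewrite -(chb t); case: (zt i).
apply/colP => i; rewrite [RHS]mxE; apply: inV_eq0 => d.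
have [M dM] := big d.
have [Mf MfP] := choice (fun j => sP j d); pose t := (M + \max_j Mf j)%N.
rewrite mxE -(subrK (evalS (zs t) (G i)) (evalS s _)); apply: coef_geD.
  apply: inV_eval_sub => j; apply/inVBC/MfP.
  by apply: leq_trans (leq_addl _ _); apply: leq_bigmax.
have [[_ _ /(_ i)[_ Gt] _ _] _] := chain_newton_hyp t.
rewrite mxE (chain_c t ch) in Gt; apply: inV_le Gt; apply: dM.
by rewrite leq_addr.
Qed.

End Chain.

Lemma newton_limit_exists P z : newton_hyp G P z -> coef_hyp G N delta (b_alpha P) ->
  exists s, [/\ Gval G s = 0, forall i, inV (Num.min (b_b P) (b_c P)) (s i 0),
    newton_limit_estimate G N delta P z s &
    forall Ps, bounds_chain N delta P Ps -> forall i, inV (b_b (Ps 2%N)) (s i 0)].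
Proof.
move=> hP cP; have P0 := newton_hyp_pos hP; have [N2 _ _] := cP.
(* One chain serves to construct [s]. The iterates do not depend on it, so the bounds of any other
   chain also pass to the limit. *)
have [Ps0 ch0] := chain_exists delta n_gt0 m_gt0 N2 P0.
have [s [Gs sV sP]] := newton_converges hP cP ch0.
exists s; split=> //; last first.
  by move=> Ps ch i; apply: (tconverges_coef_ge (sP i)) => t /(chain_2W hP cP ch i)[].
split; last 2 first.
- move=> Ps ch; split.
  + by move=> t; case: (chain_newton_hyp hP cP ch t).
  + exact: chain_same_W P0 ch (chain_b2 P0 ch).
  + by move=> t t2 i; case: (chain_2W hP cP ch i t2).
  by move=> i; apply: (tconverges_coef_ge (sP i)) => t /(chain_2W hP cP ch i)[].
- split; first by move=> t i; apply: chain_simple_W ch0 t i.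
  move=> i; apply: (tconverges_coef_ge (sP i) (N := 0%N)) => t _.
  exact: chain_simple_W ch0 t i.
- move=> c; have [Mf MfP] := choice (fun j => sP j c).
  exists (\max_j Mf j)%N => t Mt j; apply: MfP; apply: leq_trans Mt.
  exact: leq_bigmax.
by exists Ps0.
Qed.

End NewtonEstimates.

(** * The Frobenius system modulo the uniformizer *)

Lemma eq_mmap (n : nat) (A B : nzRingType) (io io' : A -> B) (y y' : 'I_n -> B) p :
  io =1 io' -> y =1 y' -> mmap io y p = mmap io' y' p.
Proof. by move=> /funext -> /funext ->. Qed.

Lemma rmorph_mmap (n : nat) (A B C : comNzRingType) (io : A -> B) (y : 'I_n -> B)
    (phi : {rmorphism B -> C}) p :
  phi (mmap io y p) = mmap (fun a => phi (io a)) (fun i => phi (y i)) p.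
Proof.
rewrite /mmap rmorph_sum; apply: eq_bigr => J _; rewrite rmorphM; congr (_ * _).
by rewrite /mmap1 rmorph_prod; apply: eq_bigr => i _; rewrite rmorphXn.
Qed.

Lemma submm (n : nat) (J : 'X_{1..n}) : (J - J)%MM = 0%MM.
Proof. by apply/mnmP => i; rewrite mnmBE mnm0E subnn. Qed.

Lemma exprDn_sum (A : comNzRingType) q (I : Type) (s : seq I) (E : I -> A) :
  [pchar A].-nat q -> (\sum_(i <- s) E i) ^+ q = \sum_(i <- s) E i ^+ q.
Proof.
move=> Aq; elim: s => [|i s IH]; last by rewrite !big_cons exprDn_pchar // IH.
by rewrite !big_nil expr0n; case: q Aq.
Qed.

Section Reduction.
Variables (RR : realType) (F : fieldType) (v : valuation RR F) (n : nat).
Local Notation R := (vring v).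
Local Notation tate := (tate v n).
Variables (k : fieldType) (red : {rmorphism R -> k}) (k_res : residue_field red).

(** Only finitely many coefficients are units, so a series in the Tate algebra reduces to a
    polynomial. *)
Lemma tred_exists (g : tate) : exists p : {mpoly k[n]}, forall D, p@_D = red (tcoef g D).
Proof.
have /asboolP/(_ 1)[N gN] := valP g.
exists (map_mpoly red (ps_trunc N (val g))) => D; rewrite mcoeff_map_mpoly.
have [DN|ND] := ltnP (mdeg D) N; first by rewrite mcoeff_trunc.
have -> : red (tcoef g D) = 0.
  by apply/k_res.2; apply: lt_le_trans (gN D ND); rewrite lte_fin.
rewrite /ps_trunc raddf_sum big1 /= ?rmorph0 // => E _.
rewrite mcoeffZ mcoeffX; case: eqP => [ED|]; last by rewrite mulr0.
by have := bmdeg E; rewrite ED ltnNge ND.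
Qed.

Definition tred (g : tate) : {mpoly k[n]} := projT1 (cid (tred_exists g)).

Lemma tredE g D : (tred g)@_D = red (tcoef g D).
Proof. by rewrite /tred; case: cid. Qed.

Fact tred_zmod : zmod_morphism tred.
Proof. by move=> g h; apply/mpolyP => D; rewrite mcoeffB !tredE tcoefB rmorphB. Qed.
HB.instance Definition _ := GRing.isZmodMorphism.Build tate {mpoly k[n]} tred tred_zmod.

Lemma tred_poly p : tred (tpoly p) = map_mpoly red p.
Proof. by apply/mpolyP => D; rewrite tredE mcoeff_map_mpoly. Qed.

Fact tred_monoid : monoid_morphism tred.
Proof.
split; first by rewrite -[1](rmorph1 (@tpoly _ _ v n)) tred_poly rmorph1.
move=> g h; apply/mpolyP => D; rewrite tredE tcoefM rmorph_sum.
rewrite (mcoeff_poly_mul_lin _ _ (ltnSn (mdeg D))).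
by apply: eq_bigr => E _; rewrite rmorphM !tredE.
Qed.
HB.instance Definition _ := GRing.isMonoidMorphism.Build tate {mpoly k[n]} tred tred_monoid.

Variables (pi : R) (pi_unif : uniformizer pi) (e : RR) (e_gt0 : 0 < e).
Hypothesis pi_val : vval pi = e%:E.

Lemma tred_eq0 g : tred g = 0 <-> inV e g.
Proof.
split=> [g0 D|ge]; last first.
  apply/mpolyP => D; rewrite tredE mcoeff0; apply/k_res.2.
  by apply: lt_le_trans (ge D); rewrite lte_fin.
apply: (vval_gt0_ge pi_unif pi_val); apply/k_res.2.
by rewrite -tredE g0 mcoeff0.
Qed.

Variables (p : nat) (p_prime : prime p) (p_red : red p%:R = 0) (ex : nat).
Local Notation q := (p ^ ex)%N.

Lemma pchar_mpoly : [pchar {mpoly k[n]}].-nat q.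
Proof.
apply: (@sub_in_pnat (pred1 p)); last by rewrite pnatX pnat_id.
move=> _ _ /eqP ->; rewrite inE p_prime /=.
by rewrite -(rmorph_nat (@mpolyC n k)) -(rmorph_nat red) p_red rmorph0.
Qed.

Lemma q_gt0 : (0 < q)%N.
Proof. by rewrite expn_gt0 prime_gt0. Qed.

Lemma frobenius_mmap (f : {mpoly R[n]}) :
  mmap (fun a => ((red a) ^+ q)%:MP) (fun i => 'X_i ^+ q) f = (map_mpoly red f) ^+ q.
Proof.
rewrite /map_mpoly /mmap exprDn_sum; last exact: pchar_mpoly.
apply: eq_bigr => J _; rewrite exprMn /=; congr (_ * _).
  by rewrite rmorphXn.
rewrite /mmap1 -prodrXl; by apply: eq_bigr => i _; rewrite -!exprM mulnC.
Qed.

Variables (sigma : {rmorphism R -> R}).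
Hypothesis sigma_frob : forall a, red (sigma a) = red a ^+ q.

Lemma psi_X i : psi q sigma ('X_i : {mpoly R[n]}) = 'X_i ^+ q.
Proof.
by rewrite -[LHS]/(mmap (@mpolyC n R \o sigma) (fun i => 'X_i ^+ q) 'X_i) mmapX mmap1U.
Qed.

Lemma red_psi (f : {mpoly R[n]}) : map_mpoly red (psi q sigma f) = (map_mpoly red f) ^+ q.
Proof.
rewrite /psi rmorph_mmap -frobenius_mmap; apply: eq_mmap => [a|i].
  by rewrite /= map_mpolyC -sigma_frob.
by rewrite rmorphXn /= map_mpolyX.
Qed.

Section System.
Variables (m : nat) (f : 'I_m -> {mpoly R[n]}) (P : 'M[{mpoly R[n]}]_(n, m)).
Variable Delta : 'I_m -> 'M[{mpoly R[n]}]_m.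
Hypothesis P_Delta : map_mx (map_mpoly red) (Jac f *m P)
               = map_mx (map_mpoly red) (1%:M + \sum_j f j *: Delta j).
Local Notation G := (frob_system q sigma f P Delta).
Variable z : 'cV[tate]_m.

(** The shift of [fsigma_shift] for an arbitrary polynomial, since the chain rule applies it to the
    partial derivatives of [f]. *)
Definition frob_subst (g : {mpoly R[n]}) : {mpoly {mpoly R[n]}[m]} :=
  mmap (fun a => ((sigma a)%:MP)%:MP)
       (fun i => (psi q sigma 'X_i)%:MP
          + (map_mx (fun p => (psi q sigma p)%:MP) P *m @Svec _ _ v n m) i 0) g.

Lemma eval_frob_subst g : evalS z (frob_subst g)
  = mmap (fun a => tconst n (sigma a)) (frob_image q sigma P z) g.
Proof.
rewrite /evalS /frob_subst rmorph_mmap; apply: eq_mmap => [a|i].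
  by rewrite /= mmapC.
rewrite /frob_image rmorphD /= mmapC; congr (_ + _).
rewrite !mxE rmorph_sum; apply: eq_bigr => l _; rewrite !mxE rmorphM /= mmapC.
by rewrite mmapX mmap1U.
Qed.

Lemma eval_Delta_term j :
  evalS z ((\sum_l (f l ^+ q)%:MP *: (map_mx (fun p => (psi q sigma p)%:MP) (Delta l) *m
             @Svec _ _ v n m)) j 0)
  = \sum_l tpoly (f l) ^+ q * (\sum_i tpoly (psi q sigma (Delta l j i)) * z i 0).
Proof.
rewrite summxE /evalS rmorph_sum; apply: eq_bigr => l _.
rewrite !mxE /= rmorphM /= mmapC /= rmorphXn; congr (_ * _).
rewrite rmorph_sum; apply: eq_bigr => i _.
by rewrite !mxE rmorphM /= mmapC mmapX mmap1U.
Qed.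

Lemma frob_system_eq j : Gval G z j 0
  = mmap (fun a => tconst n (sigma a)) (frob_image q sigma P z) (f j)
    - tpoly (f j) ^+ q
    - \sum_l tpoly (f l) ^+ q * (\sum_i tpoly (psi q sigma (Delta l j i)) * z i 0).
Proof.
rewrite mxE /frob_system -eval_frob_subst -eval_Delta_term /evalS !rmorphB /=.
by rewrite mmapC /= rmorphXn.
Qed.

Hypothesis z_pi : forall i, inV e (z i 0).

Lemma tred_frob_image i : tred (frob_image q sigma P z i) = 'X_i ^+ q.
Proof.
rewrite /frob_image rmorphD /= tred_poly red_psi map_mpolyX.
rewrite mxE rmorph_sum big1 ?addr0 // => l _.
by rewrite rmorphM /= (proj2 (tred_eq0 (z l 0))) ?mulr0.
Qed.

Lemma tred_mmap_frob g : tred (mmap (fun a => tconst n (sigma a)) (frob_image q sigma P z) g)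
  = (map_mpoly red g) ^+ q.
Proof.
rewrite rmorph_mmap -frobenius_mmap; apply: eq_mmap => [a|i].
  by rewrite /= tred_poly map_mpolyC -sigma_frob.
by apply: tred_frob_image.
Qed.

Lemma Gval_frob_pi j : inV e (Gval G z j 0).
Proof.
apply/tred_eq0; rewrite frob_system_eq !rmorphB /= tred_mmap_frob.
rewrite rmorphXn /= tred_poly subrr rmorph_sum big1 ?subr0 //= => l _.
rewrite rmorphM rmorph_sum /= big1 ?mulr0 // => i _.
by rewrite rmorphM /= (proj2 (tred_eq0 (z i 0))) ?mulr0.
Qed.

Lemma mderiv_mulSvec (a : nat) (A : 'M[{mpoly R[n]}]_(a, m)) i l :
  mderiv l ((map_mx (fun p => (psi q sigma p)%:MP) A *m @Svec _ _ v n m) i 0)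
  = (psi q sigma (A i l))%:MP.
Proof.
rewrite mxE raddf_sum (bigD1 l) //= big1 ?addr0.
  by rewrite !mxE mderiv_mulC mderivX mnm1E eqxx scale1r submm mpolyX0 mulr1.
move=> i' il; rewrite !mxE mderiv_mulC mderivX mnm1E (negPf il).
by rewrite scale0r mulr0.
Qed.

(** Modulo [pi] each entry of the Jacobian matrix of [G] is the [q]-th power of the corresponding
    entry of [Jac f *m P], minus that of the sum of the [f j *: Delta j]. By [P_Delta] and
    additivity of the Frobenius only the [q]-th power of an entry of the identity remains: the
    [Delta] term in [G] is there to cancel the defect of [P] as a right inverse. *)
Lemma JacG_frob_pi j l : inV e (JacG G z j l - (j == l)%:R).
Proof.
apply/tred_eq0; rewrite mxE rmorphB /= rmorph_nat.
have -> : mderiv l (G j) =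
    \sum_i frob_subst (mderiv i (f j)) * (psi q sigma (P i l))%:MP
    - \sum_l' (f l' ^+ q)%:MP * (psi q sigma (Delta l' j l))%:MP.
  rewrite /frob_system !mderivB mderivC subr0; congr (_ - _).
    rewrite /fsigma_shift.
    rewrite (mderiv_mmap (io := (@mpolyC m _ \o (@mpolyC n _ \o sigma))%FUN)); last first.
      by move=> a; rewrite mderivC.
    apply: eq_bigr => i _; congr (_ * _).
    by rewrite mderivD mderivC add0r mderiv_mulSvec.
  rewrite summxE raddf_sum; apply: eq_bigr => l' _.
  by rewrite mxE /= mderiv_mulC mderiv_mulSvec.
have tconstE (g : {mpoly R[n]}) : tred (evalS z g%:MP) = map_mpoly red g.
  by rewrite /evalS mmapC tred_poly.
have evalM a b : evalS z (a * b) = evalS z a * evalS z b by apply: rmorphM.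
have evalsum (I : finType) (E : I -> {mpoly {mpoly R[n]}[m]}) :
  evalS z (\sum_i E i) = \sum_i evalS z (E i) by apply: rmorph_sum.
have tredsum (I : finType) (E : I -> tate) :
  tred (\sum_i E i) = \sum_i tred (E i) by apply: rmorph_sum.
rewrite [evalS _ _]rmorphB [tred _]rmorphB /= -!/(evalS z _) !evalsum !tredsum.
have -> : \sum_i tred (evalS z (frob_subst (mderiv i (f j)) * (psi q sigma (P i l))%:MP))
    = (map_mpoly red ((Jac f *m P) j l)) ^+ q.
  rewrite mxE rmorph_sum exprDn_sum; last exact: pchar_mpoly.
  apply: eq_bigr => i _; rewrite evalM rmorphM /= tconstE red_psi.
  by rewrite eval_frob_subst tred_mmap_frob mxE rmorphM exprMn.
have -> : \sum_i tred (evalS z ((f i ^+ q)%:MP * (psi q sigma (Delta i j l))%:MP))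
    = (map_mpoly red ((\sum_i f i *: Delta i) j l)) ^+ q.
  rewrite summxE rmorph_sum exprDn_sum; last exact: pchar_mpoly.
  apply: eq_bigr => i _; rewrite evalM rmorphM /= !tconstE red_psi.
  by rewrite mxE rmorphM exprMn rmorphXn.
have := congr1 (fun A : 'M_m => A j l) P_Delta; rewrite mxE [RHS]mxE => ->.
rewrite [(1%:M + _) j l]mxE rmorphD exprDn_pchar; last exact: pchar_mpoly.
rewrite [1%:M j l]mxE rmorph_nat addrK.
by case: eqP => _; rewrite ?expr1n ?expr0n ?subrr // gtn_eqF ?q_gt0 // subrr.
Qed.

End System.

End Reduction.

(** * Uniqueness of the small solution and a starting point *)

Section Solution.
Variables (RR : realType) (F : fieldType) (v : valuation RR F) (n m : nat).
Local Notation R := (vring v).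
Local Notation tate := (tate v n).
Variable G : 'I_m -> {mpoly {mpoly R[n]}[m]}.
Variables (e : RR) (e_gt0 : 0 < e).

(** As [Jac_G(s)] is [1] modulo [V(e)], the difference of two solutions lies in
    [V(c + e)] as soon as it lies in [V(c)] with [e <= c]. *)
Lemma Gval_inj_small (s s' : 'cV[tate]_m) :
  (forall i j, inV e (JacG G s i j - (i == j)%:R)) ->
  (forall i, inV e (s i 0)) -> (forall i, inV e (s' i 0)) ->
  Gval G s = 0 -> Gval G s' = 0 -> s' = s.
Proof.
move=> Js se se' Gs Gs'; pose h := s' - s.
suff hN N i : inV (N.+1%:R * e) (h i 0).
  apply/colP => i; apply/eqP; rewrite -subr_eq0; apply/eqP/inV_eq0 => c.
  have [N cN] := nat_mul_big c e_gt0.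
  by have := hN N i; rewrite !mxE; apply: inV_le; apply: cN.
elim: N i => [|N IH] i; first by rewrite mul1r !mxE; apply: coef_geB; [exact: se'|exact: se].
pose c := N.+1%:R * e; have ec : e <= c by rewrite ler_peMl ?(ltW e_gt0) // (ler_nat _ 1).
(* Both values of [G] vanish, so [Jac_G(s) h] is, up to sign, the Taylor remainder, of order at
   least 2 in [h]. *)
have Jh : inV (2 * c) (\sum_j JacG G s i j * h j 0).
  have := eval_taylor2 s h (G i); have -> : s + h = s' by rewrite /h addrC subrK.
  have Gi (x : 'cV[tate]_m) : Gval G x = 0 -> evalS x (G i) = 0.
    by move=> /(congr1 (fun y : 'cV_m => y i 0)); rewrite !mxE.
  rewrite !Gi // subrr sub0r => /(congr1 -%R); rewrite opprK => JhE.
  have -> : \sum_j JacG G s i j * h j 0 = \sum_j evalS s (mderiv j (G i)) * h j 0.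
    by apply: eq_bigr => j _; rewrite [JacG _ _ _ _]mxE.
  rewrite JhE; apply/coef_geN/coef_ge_sum => J _; apply: (@inVMl _ _ _ _ (2 * c)).
  have := @mmap1_taylor2 _ _ (fun i => s i 0) (fun i => h i 0) J.
  apply=> [|a b|L LJ L2]; [exact: coef_ge0|exact: coef_geD|].
  apply: (@inVMl _ _ _ _ (2 * c)).
  have l0D (D E : 'X_{1..n}) : (0 : RR) = 0 + 0 by rewrite addr0.
  apply: (@inV_le _ _ _ _ ((mdeg L)%:R * c)).
    by rewrite ler_wpM2r ?(ler_nat _ 2) // (le_trans (ltW e_gt0)).
  apply/(inV_aff (fun=> 0)); rewrite -mulrN; apply: (aff_mmap1 l0D) => k.
  exact: (proj1 (inV_aff _ _ _) (IH k)).
have -> : h i 0 = \sum_j JacG G s i j * h j 0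
    - \sum_j (JacG G s i j - (i == j)%:R) * h j 0.
  rewrite -sumrB (bigD1 i) //= big1 ?addr0 => [|j ji].
    by rewrite eqxx -mulrBl opprB addrC subrK mul1r.
  by rewrite eq_sym (negPf ji) subr0 subrr.
apply: coef_geB; first by apply: inV_le Jh; rewrite -natr1 mulrDl mul1r -/c; lra.
apply: coef_ge_sum => j _; apply: (@inV_le _ _ _ _ (e + c)); last exact: inVM.
by rewrite -natr1 mulrDl mul1r -/c addrC.
Qed.

Lemma evalS0 p : evalS (0 : 'cV[tate]_m) p = tpoly p@_0%MM.
Proof.
have -> : p@_0%MM = \sum_(J <- msupp p) p@_J *+ (J == 0%MM).
  rewrite {1}(mpolyE p) raddf_sum; apply: eq_bigr => J _.
  by rewrite /= mcoeffZ mcoeffX mulr_natr.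
rewrite raddf_sum /evalS /mmap; apply: eq_bigr => J _.
have -> : mmap1 (fun l => (0 : 'cV[tate]_m) l 0) J = (J == 0%MM)%:R.
  have [->|J0] := eqVneq J 0%MM; first by rewrite mmap11.
  have [j Jj] : exists j, (0 < J j)%N.
    apply/existsP; move: J0; apply: contraNT => /existsPn J0.
    apply/eqP/mnmP => j; apply/eqP.
    by rewrite mnm0E -leqn0 leqNgt; apply: J0.
  by rewrite /mmap1 (bigD1 j) //= mxE expr0n gtn_eqF // mul0r.
by rewrite raddfMn mulr_natr.
Qed.

Lemma mwt_const (A : RR) (D : 'X_{1..n}) : mwt (const_mx A) D = (mdeg D)%:R / A.
Proof.
rewrite /mwt /wt mdegE natr_sum mulr_suml; apply: eq_bigr => i _.
by rewrite !mxE mulrC.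
Qed.

Hypothesis v_complete : forall u, cauchy v u -> exists l, converges v u l.
Hypothesis n_gt0 : (0 < n)%N.

(** The values at [z = 0] are polynomials divisible by [pi], so the slopes
    [1 / alpha_i] can be taken small enough for them to lie in [W(alpha, 0)]. *)
Lemma newton_start :
  (forall j, inV e (Gval G 0 j 0)) ->
  (forall i j, inV e (JacG G 0 i j - (i == j)%:R)) ->
  exists (B : bounds RR n) (N : nat) (delta : 'I_m -> 'X_{1..m} -> 'rV[RR]_n),
    [/\ newton_hyp G B 0, coef_hyp G N delta (b_alpha B), b_b B = e & b_c B = e].
Proof.
move=> Ge Je.
pose g j := (G j)@_0%MM; pose jac i j := (mderiv j (G i))@_0%MM - (i == j)%:R.
pose d := (\sum_j msize (g j) + \sum_i \sum_j msize (jac i j))%N.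
(* As [A * e >= d], exponents of degree at most [d] have weight at most [e], so divisibility by [pi]
   implies membership in [W(al, 0)]. The summand 1 gives [A >= 1], used for the coefficients of [G]
   below. *)
pose A : RR := 1 + d%:R / e; pose al : 'rV[RR]_n := const_mx A.
have de0 : 0 <= d%:R / e by rewrite divr_ge0 // ltW.
have A1 : 1 <= A by rewrite lerDl.
have A0 : 0 < A by apply: lt_le_trans A1.
have dA : d%:R <= A * e by rewrite mulrDl mul1r divfK ?gt_eqF // lerDr ltW.
have smallW x : (msize x <= d)%N -> inV e (tpoly x) -> inW al 0 (tpoly x).
  move=> xd xe; apply/inW_aff => D; rewrite wt0 subr0 mul1r mwt_const tcoef_poly.
  have [Dx|Dx] := boolP (D \in msupp x); last first.
    by rewrite (memN_msupp_eq0 Dx) vval0 leey.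
  apply: le_trans (xe D); rewrite lee_fin ler_pdivrMr // mulrC.
  apply: le_trans dA; rewrite ler_nat; apply: leq_trans xd.
  exact/ltnW/msize_mdeg_lt.
have GW j : inW al 0 (Gval G 0 j 0).
  have := Ge j; rewrite mxE evalS0; apply: smallW.
  by rewrite /d (bigD1 j) //= -addnA leq_addr.
have JE i j : JacG G 0 i j - (i == j)%:R = tpoly (jac i j).
  by rewrite mxE evalS0 /jac rmorphB rmorph_nat.
have JW' i j : inW al 0 (JacG G 0 i j - (i == j)%:R).
  have := Je i j; rewrite JE; apply: smallW.
  apply: leq_trans (leq_addl _ _); rewrite (bigD1 i) //=.
  by apply: leq_trans (leq_addr _ _); rewrite (bigD1 j) //= leq_addr.
have lD := @mwtD RR n al.
have J1 : forall i j, aff (mwt al) 1 0 ((1%:M : 'M[tate]_m) i j).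
  by move=> i j; rewrite mxE; case: (i == j); [exact: (aff1 _ lD)|exact: coef_ge0].
have JW i j : aff (mwt al) 1 0 (JacG G 0 i j).
  rewrite -[JacG G 0 i j](subrK (i == j)%:R); apply: coef_geD.
    by have /inW_aff := JW' i j; rewrite wt0.
  by have := J1 i j; rewrite mxE.
have al0 i : 0 < al 0 i by rewrite mxE.
(* With the size of the coefficient as the weight of [delta], the required bound is nonpositive on
   its support, so integrality suffices. *)
have [dl dlE] := choice (fun x : 'I_m * 'X_{1..m} =>
  wt_surj ((msize (G x.1)@_x.2)%:R) n_gt0 al0).
exists (Bounds al 0 0 e e), (2 + \sum_i msize (G i))%N, (fun i J => dl (i, J)).
split=> //=; last first.
  split=> // [i J|i J _].
    rewrite (bigD1 i) //= => NJ; apply/memN_msupp_eq0/msize_mdeg_ge.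
    by apply: leq_trans (ltnW NJ); rewrite addnCA leq_addr.
  apply/inW_aff => D; rewrite dlE mul1r mwt_const tcoef_poly /=.
  have [Dx|Dx] := boolP (D \in msupp (G i)@_J); last first.
    by rewrite (memN_msupp_eq0 Dx) vval0 leey.
  apply: vval_ge_npos; rewrite subr_le0 ler_pdivrMr //.
  apply: (@le_trans _ _ (msize (G i)@_J)%:R); last by rewrite ler_peMr.
  by rewrite ler_nat; apply/ltnW/msize_mdeg_lt.
split=> //=.
- by move=> i; rewrite mxE; split; exact: coef_ge0.
- split; first by move=> i j; apply/inW_aff; rewrite wt0.
  apply/W0unit_aff; apply: (aff_unit_det lD v_complete e_gt0 JW J1).
    by move=> i j; rewrite [1%:M i j]mxE.
  have a1 := @aff1 _ _ v _ _ lD 1.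
  by rewrite det1; split=> //; exists 1; rewrite mulr1.
Qed.

Lemma inW_overconvergent (al be : 'rV[RR]_n) (g : tate) :
  (forall i, 0 < al 0 i) -> inW al be g -> overconvergent (val g).
Proof.
move=> al0 /inW_aff gW.
exists (\big[Num.min/1]_i (al 0 i)^-1), (- wt al be); split.
  by apply: lt_bigmin => // i _; rewrite invr_gt0.
move=> D; apply: le_trans (gW D); rewrite lee_fin mul1r lerD2r.
rewrite /mwt /wt mdegE natr_sum mulr_sumr; apply: ler_sum => i _.
by rewrite mxE ler_wpM2r // bigmin_le_cond.
Qed.

Lemma overconvergent_div (a : R) (g h : tate) : vval a = e%:E ->
  g = tconst n a * h -> overconvergent (val g) -> overconvergent (val h).
Proof.
move=> va -> [c [d [c0 gP]]]; exists c, (d - e); split=> // D.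
have := gP D; rewrite -[scoef _ _]/(tcoef _ D) tcoefCM vvalM va.
rewrite -[scoef _ _]/(tcoef h D); case: (vval _) => [r| |]; rewrite ?leey //.
by rewrite -EFinD !lee_fin; lra.
Qed.

End Solution.

(** * Semilinear endomorphisms and quotients *)

Section MkRMorphism.
Variables (A B : pzRingType) (f : A -> B).
Hypotheses (f_zmod : zmod_morphism f) (f_monoid : monoid_morphism f).

Definition mk_rmorph of zmod_morphism f & monoid_morphism f := f.
HB.instance Definition _ :=
  GRing.isZmodMorphism.Build A B (mk_rmorph f_zmod f_monoid) f_zmod.
HB.instance Definition _ :=
  GRing.isMonoidMorphism.Build A B (mk_rmorph f_zmod f_monoid) f_monoid.

Lemma rmorph_exists : exists F : {rmorphism A -> B}, forall x, F x = f x.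
Proof. by exists (mk_rmorph f_zmod f_monoid). Qed.
End MkRMorphism.

Section Quotient.
Variables (A B : comPzRingType) (I J : finType) (g : I -> A) (g' : J -> B).

Lemma gen_ideal_gen j : g' j \in gen_ideal g'.
Proof.
apply/gen_idealP; exists (fun i => (i == j)%:R).
rewrite (bigD1 j) //= eqxx mul1r big1 ?addr0 // => i ij.
by rewrite (negPf ij) mul0r.
Qed.

Lemma rmorph_quo (phi : {rmorphism A -> B}) : (forall i, phi (g i) \in gen_ideal g') ->
  exists Phi : {rmorphism quo g -> quo g'}, forall a, Phi (cls g a) = cls g' (phi a).
Proof.
move=> phiI; pose f (x : quo g) := cls g' (phi (repr x)).
have fE a : f (cls g a) = cls g' (phi a).
  apply/clsP; rewrite -rmorphB.
  have /gen_idealP[c ->] : repr (cls g a) - a \in gen_ideal g.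
    by apply/clsP; rewrite cls_repr.
  rewrite rmorph_sum; apply: rpred_sum => i _.
  by rewrite rmorphM; apply/gen_idealMl/phiI.
have fz : zmod_morphism f.
  move=> x y; rewrite -(cls_repr x) -(cls_repr y) -rmorphB !fE.
  by rewrite -rmorphB -rmorphB.
have fm : monoid_morphism f.
  split; first by have := fE 1; rewrite !rmorph1.
  move=> x y; rewrite -(cls_repr x) -(cls_repr y) -rmorphM !fE.
  by rewrite -rmorphM -rmorphM.
have [Phi PhiE] := rmorph_exists fz fm.
by exists Phi => a; rewrite PhiE fE.
Qed.

End Quotient.

(** The shape that [G(s) = 0] gives to the image of [f j]; each power splits off a generator because
    [q > 0]. *)
Lemma sum_powers_gen_ideal (A : comPzRingType) (m q : nat) (g c : 'I_m -> A) j :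
  (0 < q)%N -> g j ^+ q + \sum_l g l ^+ q * c l \in gen_ideal g.
Proof.
case: q => // q _; apply: rpredD.
  by rewrite exprSr; apply/gen_idealMl/gen_ideal_gen.
apply: rpred_sum => l _; rewrite mulrC exprSr mulrA.
exact/gen_idealMl/gen_ideal_gen.
Qed.

Lemma subrACA (A : zmodType) (a b c d : A) : a - b - (c - d) = a - c - (b - d).
Proof. by rewrite opprD addrACA -opprD. Qed.

Lemma mulr_subM (A : comNzRingType) (a b c d : A) :
  a * b - c * d = b * (a - c) + c * (b - d).
Proof. ring. Qed.

(** * Extension of a semilinear substitution by continuity *)

Section Extension.
Variables (RR : realType) (F : fieldType) (v : valuation RR F) (n : nat).
Local Notation R := (vring v).
Local Notation tate := (tate v n).
Hypothesis v_complete : forall u, cauchy v u -> exists l, converges v u l.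
Variables (sigma : {rmorphism R -> R}) (y : 'I_n -> tate).
Hypothesis sigma_ge : forall (c : RR) a, (c%:E <= vval a)%E -> (c%:E <= vval (sigma a))%E.

Local Notation io := (@tpoly _ _ v n \o (@mpolyC n R \o sigma))%FUN.
Local Notation phi0 := (mmap io y).

(** A truncation of [g] works. The clause on the coefficients lets the approximation inherit the
    decay of [g], as overconvergence requires. *)
Lemma tate_approx (g : tate) (c : RR) : exists2 p, inV c (g - tpoly p) &
  forall D, p@_D = tcoef g D \/ p@_D = 0.
Proof.
have /asboolP/(_ c)[N gN] := valP g.
exists (ps_trunc N (val g)) => D; last first.
  have [DN|ND] := ltnP (mdeg D) N; first by left; rewrite mcoeff_trunc.
  right; rewrite /ps_trunc raddf_sum big1 //= => E _.
  rewrite mcoeffZ mcoeffX; case: eqP => [ED|]; last by rewrite mulr0.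
  by have := bmdeg E; rewrite ED ltnNge ND.
rewrite tcoefB tcoef_poly.
have [DN|ND] := ltnP (mdeg D) N.
  by rewrite mcoeff_trunc // subrr vval0 leey.
rewrite [(ps_trunc _ _)@_D](_ : _ = 0) ?subr0; first exact: gN.
rewrite /ps_trunc raddf_sum big1 //= => E _.
rewrite mcoeffZ mcoeffX; case: eqP => [ED|]; last by rewrite mulr0.
by have := bmdeg E; rewrite ED ltnNge ND.
Qed.

Lemma phi0_inV c p : inV c (tpoly p) -> inV c (phi0 p).
Proof.
move=> pc; apply: coef_ge_sum => J _; rewrite mulrC; apply: (@inVMl _ _ _ _ c).
by apply/inV_tconst/sigma_ge/pc.
Qed.

(** The image is specified against all polynomial approximations at every precision, so that no
    later argument depends on the sequence chosen here. *)
Lemma phi_exists g : exists h, forall c p, inV c (g - tpoly p) -> inV c (h - phi0 p).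
Proof.
have ap (k : nat) : {p | inV (k%:R : RR) (g - tpoly p)}.
  by apply: cid; have [p gp _] := tate_approx g k%:R; exists p.
pose P k := projT1 (ap k); have PE k : inV (k%:R : RR) (g - tpoly (P k)) := projT2 (ap k).
have big (c : RR) : exists N, forall i, (N <= i)%N -> c <= i%:R.
  by have [N NP] := @nat_mul_big _ c 1 ltr01; exists N => i /NP; rewrite mulr1.
have sub0 c p q : inV c (g - tpoly p) -> inV c (g - tpoly q) -> inV c (phi0 p - phi0 q).
  move=> gp gq; rewrite -rmorphB; apply: phi0_inV; rewrite rmorphB.
  have -> : tpoly p - tpoly q = (g - tpoly q) - (g - tpoly p) by ring.
  exact: coef_geB.
have [|h hP] := tate_complete v_complete (u := fun k => phi0 (P k)).
  move=> c; have [N NP] := big c; exists N => i Ni; apply: sub0.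
    by apply: inV_le (PE i.+1); apply: NP; apply: leqW.
  by apply: inV_le (PE i); apply: NP.
exists h => c p gp; have [N NP] := big c; have [M MP] := hP c.
pose k := (M + N)%N; rewrite -(subrKA (phi0 (P k))); apply: coef_geD.
  by apply/inVBC/MP; rewrite leq_addr.
by apply: sub0 => //; apply: inV_le (PE k); apply: NP; rewrite leq_addl.
Qed.

Definition tate_ext (g : tate) : tate := projT1 (cid (phi_exists g)).

Lemma tate_extP g c p : inV c (g - tpoly p) -> inV c (tate_ext g - phi0 p).
Proof. by rewrite /tate_ext; case: (cid _) => h /= hP; apply: hP. Qed.

(** One approximation per precision pins down the image; the ring laws for the extension thereby
    reduce to those for [phi0]. *)
Lemma tate_ext_uniq g h :
  (forall c, exists2 p, inV c (g - tpoly p) & inV c (h - phi0 p)) -> h = tate_ext g.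
Proof.
move=> H; apply/eqP; rewrite -subr_eq0; apply/eqP/inV_eq0 => c.
have [p gp hp] := H c; rewrite -(subrKA (phi0 p)); apply: coef_geD => //.
by apply/inVBC/tate_extP.
Qed.

Lemma tate_ext_poly p : tate_ext (tpoly p) = phi0 p.
Proof.
by apply/esym/tate_ext_uniq => c; exists p; rewrite subrr; apply: coef_ge0.
Qed.

Fact tate_ext_zmod : zmod_morphism tate_ext.
Proof.
move=> g h; apply/esym/tate_ext_uniq => c.
have [p gp _] := tate_approx g c; have [q hq _] := tate_approx h c; exists (p - q).
  by rewrite rmorphB subrACA; apply: coef_geB.
by rewrite rmorphB subrACA; apply: coef_geB; apply: tate_extP.
Qed.

Fact tate_ext_monoid : monoid_morphism tate_ext.
Proof.
split; first by have := tate_ext_poly 1; rewrite !rmorph1.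
move=> g h; apply/esym/tate_ext_uniq => c.
have [p gp _] := tate_approx g c; have [q hq _] := tate_approx h c; exists (p * q).
  by rewrite rmorphM mulr_subM; apply: coef_geD; [exact: inVMl gp|exact: inVMl hq].
rewrite rmorphM mulr_subM.
by apply: coef_geD; apply: (@inVMl _ _ _ _ c); apply: tate_extP.
Qed.

HB.instance Definition _ := GRing.isZmodMorphism.Build tate tate tate_ext tate_ext_zmod.
HB.instance Definition _ := GRing.isMonoidMorphism.Build tate tate tate_ext tate_ext_monoid.

Lemma tate_ext_const a : tate_ext (tconst n a) = tconst n (sigma a).
Proof. by rewrite tate_ext_poly mmapC. Qed.

Lemma tate_ext_semilinear : sigma_semilinear (@tconst _ _ v n) sigma tate_ext.
Proof. by move=> a g; rewrite rmorphM /= tate_ext_const. Qed.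

Lemma tate_ext_X i : tate_ext (tpoly 'X_i) = y i.
Proof. by rewrite tate_ext_poly mmapX mmap1U. Qed.

Lemma semilinear_poly (phi : {rmorphism tate -> tate}) :
  sigma_semilinear (@tconst _ _ v n) sigma phi ->
  (forall i, phi (tpoly 'X_i) = y i) -> forall p, phi (tpoly p) = phi0 p.
Proof.
move=> phiS phiX p.
have pE : p = mmap (@mpolyC n R) (fun i => 'X_i) p.
  rewrite {1}(mpolyE p) /mmap; apply: eq_bigr => J _.
  by rewrite mmap1_id mul_mpolyC.
have -> : tpoly p = mmap (@tconst _ _ v n) (fun i => tpoly 'X_i) p.
  by rewrite {1}pE; exact: (rmorph_mmap (@mpolyC n R) _ (@tpoly _ _ v n)).
rewrite (rmorph_mmap (@tconst _ _ v n) _ phi).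
apply: eq_mmap => [a|i]; last exact: phiX.
by have := phiS a 1; rewrite !mulr1 rmorph1 mulr1.
Qed.

Variables (pi : R) (e : RR).
Hypotheses (e_gt0 : 0 < e) (pi_val : vval pi = e%:E).

(** A semilinear [phi] is automatically continuous, as it maps [pi^N g] to
    [sigma(pi)^N phi(g)]. *)
Lemma semilinear_uniq (phi : {rmorphism tate -> tate}) :
  sigma_semilinear (@tconst _ _ v n) sigma phi ->
  (forall i, phi (tpoly 'X_i) = y i) -> phi =1 tate_ext.
Proof.
move=> phiS phiX g; apply: tate_ext_uniq => c.
have [N /(_ N (leqnn N)) cN] := nat_mul_big c e_gt0.
have [p gp _] := tate_approx g (N%:R * e); exists p; first exact: inV_le gp.
apply: (inV_le cN).
rewrite -(semilinear_poly phiS phiX) -rmorphB.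
have piN := vval_expr N pi_val.
have [h ->] := tconst_div piN gp; rewrite phiS [tconst _ _ * _]mulrC.
apply: (@inVMl _ _ _ _ (N%:R * e)).
by apply/inV_tconst/sigma_ge; rewrite piN.
Qed.

(** Since the [y i] are integral, their bound may be weakened by a factor [t <= 1],
    and for small [t] the loss [t d |D|] is absorbed by the decay of the
    coefficients of [g]. *)
Lemma tate_ext_overconvergent g : (forall i, overconvergent (val (y i))) ->
  overconvergent (val g) -> overconvergent (val (tate_ext g)).
Proof.
move=> yo [a [b [a0 gab]]].
have [C CP] := choice yo; have [D DP] := choice CP.
pose c := \big[Num.min/1]_i C i; pose d := \big[Num.min/0]_i D i.
have c0 : 0 < c by apply: lt_bigmin => // i _; have [] := DP i.
have d0 : d <= 0 by apply: bigmin_le_id.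
(* Chosen so that [t <= 1] and [t * (1 - d) <= a], hence [a + t * d >= 0]; the 1 in [1 - d] keeps
   the divisor positive when [d = 0]. *)
pose t := Num.min 1 (a / (1 - d)).
have d1 : 0 < 1 - d by lra.
have t0 : 0 < t by rewrite lt_min ltr01 divr_gt0.
have t1 : t <= 1 by rewrite ge_min lexx.
have td : t * (1 - d) <= a by rewrite -ler_pdivlMr // ge_min lexx orbT.
pose l (E : 'X_{1..n}) : RR := (mdeg E)%:R.
have lD E E' : l (E + E')%MM = l E + l E' by rewrite /l mdegD natrD.
have ybd i : aff l (t * c) (- (t * d)) (y i).
  have [Ci yi] := DP i; move=> E; rewrite opprK -mulrA -mulrDr.
  have [le0|gt0] := leP (c * l E + d) 0.
    by apply: vval_ge_npos; rewrite pmulr_rle0.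
  apply: le_trans (yi E); rewrite lee_fin.
  have : c * l E + d <= C i * l E + D i.
    by rewrite lerD ?bigmin_le_cond // ler_wpM2r ?bigmin_le_cond.
  have : t * (c * l E + d) <= 1 * (c * l E + d) by rewrite ler_wpM2r // ltW.
  by rewrite /l; lra.
exists (t * c), b; split=> [|E]; first exact: mulr_gt0.
(* Only the coefficient at [E] is at stake, so approximating [g] to the precision wanted there
   reduces the claim to a polynomial. *)
pose w := t * c * l E + b.
have [p gp pg] := tate_approx g w.
apply: (@val_close _ _ _ _ _ (val (tcoef (phi0 p) E))); last first.
  by have := tate_extP gp E; rewrite tcoefB /vval raddfB.
suff : aff l (t * c) (- b) (phi0 p) by move=> /(_ E); rewrite opprK.
apply: coef_ge_sum => J _.
have tJ : aff l (t * c) ((mdeg J)%:R * - (t * d)) (mmap1 y J) by apply: aff_mmap1.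
have pJ : aff l (t * c) (- (a * l J + b)) (io p@_J).
  move=> E'; rewrite tcoef_poly mcoeffC; case: eqP => [->|_]; last first.
    by rewrite mulr0 vval0 leey.
  rewrite mulr1 /l mdeg0 mulr0 sub0r opprK; apply: sigma_ge.
  by case: (pg J) => ->; [exact: gab|rewrite vval0 leey].
apply: (affM lD _ pJ tJ).
have : 0 <= l J * (a + t * d).
  by rewrite mulr_ge0 //; move: td; rewrite mulrBr mulr1; lra.
by rewrite /l; lra.
Qed.

End Extension.

Section DaggerVal.
Variables (RR : realType) (F : fieldType) (v : valuation RR F) (n : nat).
Implicit Types g h : dagger v n.

Lemma dvalD g h : val (g + h) = val g + val h. Proof. by []. Qed.
Lemma dvalB g h : val (g - h) = val g - val h. Proof. by []. Qed.
Lemma dval1 : val (1 : dagger v n) = 1. Proof. by []. Qed.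
Lemma dvalM g h : val (g * h) = val g * val h. Proof. by []. Qed.
Lemma dval_sum (I : finType) (E : I -> dagger v n) :
  val (\sum_i E i) = \sum_i val (E i).
Proof. exact: (big_morph _ dvalD erefl). Qed.
Lemma dvalX g k : val (g ^+ k) = val g ^+ k.
Proof. by elim: k => // k IH; rewrite !exprS dvalM IH. Qed.

End DaggerVal.

(** * The Frobenius lift and its rate of convergence *)

Theorem corollary4p17
    (RR : realType) (p : nat) (p_prime : prime p)
    (Qp : fieldType) (w : valuation RR Qp) (Qp_padic : is_padic_field p w)
    (K : fieldExtType Qp) (v : valuation RR K)
    (v_ext : forall a : Qp, v (a%:A) = w a)
    (pi : vring v) (pi_unif : uniformizer pi)
    (k : fieldType) (red : {rmorphism vring v -> k}) (k_res : residue_field red)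
    (h : nat) (sigma : {rmorphism K -> K}) (sigma_bij : bijective sigma)
    (sigmaR : {rmorphism vring v -> vring v})
    (sigmaR_sigma : forall a, val (sigmaR a) = sigma (val a))
    (sigma_frob : forall a, red (sigmaR a) = red a ^+ (p ^ h)%N)
    (n r : nat) (r_lt_n : (r < n)%N)
    (f : 'I_(n - r) -> {mpoly (vring v)[n]})
    (f_smooth : jacobian_unit (fun j => map_mpoly red (f j)))
    (P : 'M[{mpoly (vring v)[n]}]_(n, n - r))
    (Delta : 'I_(n - r) -> 'M[{mpoly (vring v)[n]}]_(n - r))
    (P_Delta : map_mx (map_mpoly red) (Jac f *m P)
               = map_mx (map_mpoly red) (1%:M + \sum_j f j *: Delta j)) :
  let q := (p ^ h)%N in
  let fbar := fun j => map_mpoly red (f j) in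
  let fT := fun j => tpoly (f j) in
  let fD := fun j => dpoly (f j) in
  let G := frob_system q sigmaR f P Delta in
  exists s : 'cV[tate v n]_(n - r),
    [/\ pi_solution pi G s,
        forall s', pi_solution pi G s' -> s' = s &
        forall i, exists d : dagger v n, s i 0 = tconst n pi * val d] /\
  exists phi : {rmorphism tate v n -> tate v n},
    [/\ sigma_semilinear (@tconst _ _ v n) sigmaR phi,
        forall i, phi (tpoly 'X_i) = frob_image q sigmaR P s i &
        forall phi' : {rmorphism tate v n -> tate v n},
          sigma_semilinear (@tconst _ _ v n) sigmaR phi' ->
          (forall i, phi' (tpoly 'X_i) = frob_image q sigmaR P s i) ->
          phi' =1 phi] /\
    (exists phiA : {rmorphism quo fT -> quo fT},
       sigma_semilinear (fun a => cls fT (tconst n a)) sigmaR phiA /\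
       forall g, phiA (cls fT g) = cls fT (phi g)) /\
    (exists phid : {rmorphism dagger v n -> dagger v n},
       (forall g, val (phid g) = phi (val g)) /\
       exists phiAd : {rmorphism quo fD -> quo fD},
         [/\ sigma_semilinear (fun a => cls fD (dconst n a)) sigmaR phiAd,
             forall g, phiAd (cls fD g) = cls fD (phid g) &
             exists rho : {rmorphism quo fD -> quo fbar},
               (forall g, exists2 gbar, reduces_to red (val g) gbar &
                                        rho (cls fD g) = cls fbar gbar) /\
               forall x, rho (phiAd x) = rho x ^+ q]) /\
    (exists (B : bounds RR n) (N : nat) (delta : 'I_(n - r) -> 'X_{1..n - r} -> 'rV[RR]_n)
            (z : 'cV[tate v n]_(n - r)),
       newton_hyp G B z /\ coef_hyp G N delta (b_alpha B)) /\
    forall (B : bounds RR n) (N : nat) (delta : 'I_(n - r) -> 'X_{1..n - r} -> 'rV[RR]_n)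
           (z : 'cV[tate v n]_(n - r)),
      newton_hyp G B z -> coef_hyp G N delta (b_alpha B) ->
      [/\ newton_step_estimate G N delta B z,
          newton_limit_estimate G N delta B z s,
          forall Bs, bounds_chain N delta B Bs ->
          forall eps : 'rV[RR]_n,
            (forall i l, inW (b_alpha (Bs 2%N)) eps (tpoly (psi q sigmaR (P i l)))) ->
            forall i, let d := phi (tpoly 'X_i) - tpoly 'X_i ^+ q in
              inW (b_alpha (Bs 2%N)) (b_beta (Bs 2%N) + eps) d /\
              inV (b_b (Bs 2%N)) d &
          forall eps : 'rV[RR]_n,
            (forall i l, inW ((1 + mu N delta B) *: b_alpha B) eps
                             (tpoly (psi q sigmaR (P i l)))) ->
            forall i, inW ((1 + mu N delta B) *: b_alpha B) (b_beta B + eps)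
                          (phi (tpoly 'X_i) - tpoly 'X_i ^+ q)].
Proof.
move=> q fbar fT fD G.
have n0 : (0 < n)%N by apply: leq_ltn_trans r_lt_n.
have m0 : (0 < n - r)%N by rewrite subn_gt0.
have v_complete : forall u, cauchy v u -> exists l, converges v u l.
  by apply: finite_ext_complete v_ext => u; apply: (padic_complete Qp_padic).
have [e e0 pe] := uniformizer_val pi_unif.
(* The residue characteristic is [p] because [v] extends [w], which takes the value 1 at [p]. *)
have p_red : red p%:R = 0.
  apply/k_res.2; have -> : vval (p%:R : vring v) = 1%E.
    rewrite /vval rmorph_nat -(scaler_nat p (1 : K)) v_ext (padic_nat Qp_padic).
      by rewrite logn_prime // eqxx.
    exact: prime_gt0.
  by rewrite lte_fin.
have q0 : (0 < q)%N by apply: q_gt0.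
(* The residue of [sigmaR a] is a positive power of that of [a], so the maximal ideal is
   preserved. *)
have sigma_ge : forall (c : RR) a, (c%:E <= vval a)%E -> (c%:E <= vval (sigmaR a))%E.
  apply: (rmorph_contract pi_unif e0 pe) => a /k_res.2 ra; apply/k_res.2.
  by rewrite sigma_frob ra expr0n gtn_eqF.
have pi_small (g : tate v n) : (exists g', g = tconst n pi * g') <-> inV e g.
  split=> [[g' ->]|]; last exact: tconst_div.
  by rewrite mulrC; apply: inVMl; apply: inV_tconst; rewrite pe.
have Gpi (z : 'cV[tate v n]_(n - r)) j : (forall i, inV e (z i 0)) -> inV e (Gval G z j 0).
  by move=> ze; apply: (Gval_frob_pi k_res pi_unif e0 pe p_prime p_red sigma_frob).
have Jpi (z : 'cV[tate v n]_(n - r)) i j :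
    (forall i, inV e (z i 0)) -> inV e (JacG G z i j - (i == j)%:R).
  move=> ze.
  by apply: (JacG_frob_pi k_res pi_unif e0 pe p_prime p_red sigma_frob P_Delta ze).
have z0 i : inV e ((0 : 'cV[tate v n]_(n - r)) i 0) by rewrite mxE; apply: coef_ge0.
have [B0 [N0 [delta0 [hB0 cB0 bB0 ccB0]]]] := newton_start e0 v_complete n0
  (fun j => Gpi 0 j z0) (fun i j => Jpi 0 i j z0).
have [s [Gs sV sL _]] := newton_limit_exists v_complete n0 m0 hB0 cB0.
have se i : inV e (s i 0) by have := sV i; rewrite bB0 ccB0 minxx.
have s_uniq (s' : 'cV[tate v n]_(n - r)) :
    (forall i, inV e (s' i 0)) -> Gval G s' = 0 -> s' = s.
  move=> s'e Gs'; apply: (Gval_inj_small e0 _ se s'e Gs Gs').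
  by move=> i j; apply: Jpi.
have s_dag i : exists d : dagger v n, s i 0 = tconst n pi * val d.
  have [d sd] := (pi_small _).2 (se i).
  have [_ [Ps ch] chP _] := sL.
  have so : overconvergent (val (s i 0)).
    have [_ _ _ sW] := chP Ps ch; apply: inW_overconvergent (sW i).
    by have [] := chain_pos 2 (newton_hyp_pos hB0) ch.
  have dP : d \in dagger_pred (v:=v) (n:=n).
    by apply/asboolP; apply: overconvergent_div pe sd so.
  by exists (Sub d dP : dagger v n).
exists s; split.
  split=> //; first by split=> // i; apply/pi_small.
  by move=> s' [s'pi Gs']; apply: s_uniq => // i; apply/pi_small.
pose y := frob_image q sigmaR P s.
pose phi : {rmorphism tate v n -> tate v n} := tate_ext v_complete y sigma_ge.
have phiS : sigma_semilinear (@tconst _ _ v n) sigmaR phi := tate_ext_semilinear _ _ _.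
have phiX i : phi (tpoly 'X_i) = y i := tate_ext_X _ _ _ _.
have phi_poly p' : phi (tpoly p') = mmap (fun a => tconst n (sigmaR a)) y p'.
  exact: tate_ext_poly.
have [sd sdE] : exists sd : 'I_(n - r) -> dagger v n, forall i, s i 0 = val (sd i).
  have [d dE] := choice s_dag; exists (fun i => dconst n pi * d i) => i.
  by rewrite dE dvalM.
have phi_f j : phi (fT j) = fT j ^+ q
    + \sum_l fT l ^+ q * (\sum_i tpoly (psi q sigmaR (Delta l j i)) * s i 0).
  have := congr1 (fun A : 'cV_(n - r) => A j 0) Gs; rewrite frob_system_eq mxE.
  by rewrite -phi_poly => /eqP; rewrite subr_eq0 => /eqP <-; rewrite addrC subrK.
(* Modulo [pi] any series agrees with a polynomial, and [phi] respects this approximation. *)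
have tred_phi g : tred k_res (phi g) = tred k_res g ^+ q.
  have [p' gp' _] := tate_approx g e.
  have -> : tred k_res g = map_mpoly red p'.
    apply/eqP; rewrite -subr_eq0 -(tred_poly k_res) -rmorphB.
    exact/eqP/(tred_eq0 k_res pi_unif e0 pe).
  rewrite -(tred_mmap_frob k_res pi_unif e0 pe p_prime p_red sigma_frob P se) -/y.
  apply/eqP; rewrite -subr_eq0 -rmorphB; apply/eqP/(tred_eq0 k_res pi_unif e0 pe).
  exact: tate_extP gp'.
exists phi; split; [|split; [|split; [|split]]].
- split=> // phi' phi'S phi'X; exact: (semilinear_uniq _ _ e0 pe).
- have phiI j : phi (fT j) \in gen_ideal fT.
    by rewrite phi_f; apply: sum_powers_gen_ideal.
  have [phiA phiAE] := rmorph_quo phiI; exists phiA; split=> // a x.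
  by rewrite -(cls_repr x) -rmorphM !phiAE phiS rmorphM.
- have phi_dag (g : dagger v n) : phi (val g) \in dagger_pred (v:=v) (n:=n).
    apply/asboolP; apply: tate_ext_overconvergent; last exact/asboolP/(valP g).
    move=> i; have [d ->] : exists d : dagger v n, y i = val d.
      exists (dpoly (psi q sigmaR 'X_i) + \sum_l dpoly (psi q sigmaR (P i l)) * sd l).
      rewrite dvalD dval_sum /y /frob_image mxE; congr (_ + _).
      by apply: eq_bigr => l _; rewrite dvalM mxE sdE.
    exact/asboolP/(valP d).
  have [phid0 phid0E] : exists f : dagger v n -> dagger v n,
      forall g, val (f g) = phi (val g).
    by exists (fun g => Sub (phi (val g)) (phi_dag g)).
  have phid_zmod : zmod_morphism phid0.
    by move=> g g'; apply: val_inj; rewrite dvalB !phid0E dvalB rmorphB.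
  have phid_monoid : monoid_morphism phid0.
    split=> [|g g']; apply: val_inj; first by rewrite phid0E dval1 rmorph1.
    by rewrite dvalM !phid0E dvalM rmorphM.
  have [phid phidE0] := rmorph_exists phid_zmod phid_monoid.
  have phidE g : val (phid g) = phi (val g) by rewrite phidE0 phid0E.
  exists phid; split=> //.
  (* Membership in the ideal of the overconvergent ring needs overconvergent coefficients. The
     relation for [phi (fT j)] provides them, as its coefficients are built from polynomials and the
     overconvergent [sd]. *)
  have phidI j : phid (fD j) \in gen_ideal fD.
    have -> : phid (fD j) = fD j ^+ q
      + \sum_l fD l ^+ q * (\sum_i dpoly (psi q sigmaR (Delta l j i)) * sd i).
      apply: val_inj; rewrite phidE [LHS]phi_f dvalD dvalX dval_sum.
      congr (_ + _); apply: eq_bigr => l _; rewrite dvalM dvalX dval_sum.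
      by congr (_ * _); apply: eq_bigr => i _; rewrite dvalM sdE.
    exact: sum_powers_gen_ideal.
  have [phiAd phiAdE] := rmorph_quo phidI; exists phiAd.
  pose rd : {rmorphism dagger v n -> {mpoly k[n]}} := (tred k_res \o val)%FUN.
  have rdI j : rd (fD j) \in gen_ideal fbar.
    have -> : rd (fD j) = fbar j by apply: tred_poly.
    exact: gen_ideal_gen.
  have [rho rhoE] := rmorph_quo rdI.
  split=> //.
    move=> a x; rewrite -(cls_repr x) -rmorphM !phiAdE -rmorphM; congr (cls _ _).
    by apply: val_inj; rewrite phidE dvalM [LHS]phiS dvalM phidE.
  exists rho; split.
    by move=> g; exists (rd g) => // D; apply: tredE.
  move=> x; rewrite -(cls_repr x) phiAdE !rhoE -rmorphXn; congr (cls _ _).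
  by rewrite -[rd _]/(tred k_res (val (phid (repr x)))) phidE tred_phi.
- by exists B0, N0, delta0, 0.
move=> B N delta z hB cB.
have [s1 [Gs1 s1V s1L s1V2]] := newton_limit_exists v_complete n0 m0 hB cB.
have s1s : s1 = s.
  (* The start may have any positive [b] and [c]; positivity of the valuations is enough, since
     discreteness raises it to [e]. *)
  apply: s_uniq => // i D; apply: (vval_gt0_ge pi_unif pe).
  apply: lt_le_trans (s1V i D); rewrite lte_fin lt_min.
  by have [_ -> ->] := newton_hyp_pos hB.
rewrite {}s1s in s1V s1L s1V2 Gs1.
(* As [psi] sends each variable to its [q]-th power, the deviation of [phi] from it is exactly
   [psi(P) s], so bounds on [s] carry over. *)
have phi_sub i : phi (tpoly 'X_i) - tpoly 'X_i ^+ q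
    = \sum_l tpoly (psi q sigmaR (P i l)) * s l 0.
  rewrite phiX /y /frob_image psi_X rmorphXn /= addrC addKr mxE.
  by apply: eq_bigr => l _; rewrite mxE.
have sumW al eps be i : (forall i l, inW al eps (tpoly (psi q sigmaR (P i l)))) ->
    (forall l, inW al be (s l 0)) -> inW al (be + eps) (phi (tpoly 'X_i) - tpoly 'X_i ^+ q).
  move=> PW sW; rewrite phi_sub; apply/inW_aff; apply: coef_ge_sum => l _.
  have /inW_aff Pil := PW i l; have /inW_aff sl := sW l.
  apply: (affM (@mwtD _ _ al) _ Pil sl).
  by rewrite wtD addrC.
split.
- exact: newton_step_estimateP.
- exact: s1L.
- move=> Bs ch eps PW i d; have [_ _ chP _] := s1L; split.
    by apply: sumW => //; have [] := chP Bs ch.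
  rewrite /d phi_sub; apply: coef_ge_sum => l _; apply: (@inVMl _ _ _ _ (b_b (Bs 2%N))).
  exact: s1V2.
by move=> eps PW i; apply: sumW => //; have [_ _ _ []] := s1L.
Qed.
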